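(* Let $W\in\mathbb{R}^{N\times N}$ be symmetric, let $a\in\mathbb{R}^{N\times k}$ be side information, and let $(x_t)_{t\ge1}$ be generated by any generalized first order method (GFOM). Then there exist a deterministic RI-AMP-DF algorithm, with iterates denoted $(r_t)_{t\ge1}$, and post-processing functions $\varphi_t:\mathbb{R}^t\times\mathbb{R}^k\to\mathbb{R}$ (acting separately on the $N$ rows of their inputs), such that $$x_t=\varphi_t(r_1,\dots,r_t;a),\qquad\forall t\ge1.$$
   Context: GFOM: iterates $$x_t=W\phi_t(x_1,\dots,x_{t-1};a)+\psi_t(x_1,\dots,x_{t-1};a),\qquad t\ge1,$$ where $\phi_t,\psi_t:\mathbb{R}^{t-1}\times\mathbb{R}^k\to\mathbb{R}$ are continuously differentiable and Lipschitz, do not depend on $N$, and act separately on the $N$ rows of their inputs. Deterministic RI-AMP-DF: with $u_1=\bar u_1=\eta_1(a)\in\mathbb{R}^N$, for $t\ge1$, $$r_t=Wu_t-(c_{t,1}\bar u_1+\cdots+c_{t,t}\bar u_t),\quad u_{t+1}=\eta_{t+1}(r_1,\dots,r_t;a),\quad\bar u_{t+1}=u_{t+1}-(d_{t,1}r_1+\cdots+d_{t,t}r_t),$$ where $\eta_{t+1}:\mathbb{R}^t\times\mathbb{R}^k\to\mathbb{R}$ acts separately on the $N$ rows, and $c_{t,i},d_{t,i}$ are deterministic constants not depending on $N$, namely the limiting deterministic equivalents of the RI-AMP-DF coefficients, as follows. Let $\mu$ be the (compactly supported) limiting spectral law of $W$, and let $A$ be the square-integrable limit in law of the rows of $a$.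 Then $d_{t,i}=\mathbb{E}[\partial_i\eta_{t+1}(R_1,\dots,R_t;A)]$; $\Phi_t\in\mathbb{R}^{t\times t}$ is strictly lower triangular with $(j+1,i)$ entry $d_{j,i}$ for $1\le i\le j\le t-1$; $(c_{s,i})_{1\le i\le s\le t}=\sum_{i=1}^t\gamma_i\Phi_t^{\,i-1}$ with $\gamma_n=\mathbb{E}_{\Lambda\sim\mu}[\Lambda H_{n-1}(\Lambda)]$, $H_0=1$, $H_n(\lambda)=\lambda H_{n-1}(\lambda)-\mathbb{E}[\Lambda H_{n-1}(\Lambda)]$. Here $(R_1,\dots,R_t)$ is a centered Gaussian vector independent of $A$ with covariance $\mathbb{E}_{\Lambda\sim\mu}[G_t(\Lambda)\bar\Delta_tG_t(\Lambda)^{\mathsf T}]$, $G_t(\lambda)=\sum_{i=1}^tH_i(\lambda)\Phi_t^{\,i-1}$, $(\bar\Delta_t)_{i,j}=\mathbb{E}[\bar U_i\bar U_j]$, $\bar U_1=\eta_1(A)$, $\bar U_{j+1}=\eta_{j+1}(R_1,\dots,R_j;A)-\sum_{i=1}^jd_{j,i}R_i$ (recursively in $t$). *)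

(* Defs.v *)
From HB Require Import structures.
From mathcomp Require Export all_boot all_order all_algebra.
From mathcomp Require Export all_classical all_reals all_analysis.
Export Order.TTheory GRing.Theory Num.Theory.
Export numFieldNormedType.Exports.

Set Implicit Arguments.
Unset Strict Implicit.
Unset Printing Implicit Defensive.

Local Open Scope classical_set_scope.
Local Open Scope ring_scope.

(* Time is shifted by one: index [t : nat] of an iterate, of a nonlinearity or
   of a row/column of a matrix stands for the index t + 1 of the usual
   presentation in which time starts at 1.  Thus [phi t] and [eta t], functions
   of the [t] previous iterates and of [k] side variables, are phi_(t+1) and
   eta_(t+1); [c t s] is c_(t+1,s+1).  The first index of [d] is the exception:
   [d t s] is d_(t,s+1) = E[d_(s+1) eta_(t+1)], the derivatives of [eta t]. *)

Section Algorithms.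
Variables (R : realType) (k : nat).

Definition nonlin (t : nat) := 'rV[R]_t * 'rV[R]_k -> R.

Definition C1 t (f : nonlin t) : Prop :=
  (forall p, differentiable f p) /\ (forall v, continuous ('D_v f)).

Definition smooth_nonlin t (f : nonlin t) : Prop := C1 f /\ lipschitz f.

(* Partial derivative in the [i]-th of the [t] first variables. *)
Definition partial t (i : 'I_t) (f : nonlin t) : nonlin t :=
  'D_(delta_mx ord0 i, 0) f.

(* [f (x_0, ..., x_(t-1); a)], acting separately on the rows. *)
Definition rowwise N t (f : nonlin t) (x : nat -> 'cV[R]_N) (a : 'M[R]_(N, k)) :
    'cV[R]_N :=
  \col_n f (\row_(s < t) x s n ord0, row n a).

Definition GFOM N (phi psi : forall t, nonlin t)
    (W : 'M[R]_N) (a : 'M[R]_(N, k)) (x : nat -> 'cV[R]_N) : Prop :=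
  forall t, x t = W *m rowwise (phi t) x a + rowwise (psi t) x a.

Definition RI_AMP_DF N (eta : forall t, nonlin t) (c d : nat -> nat -> R)
    (W : 'M[R]_N) (a : 'M[R]_(N, k)) (u ubar r : nat -> 'cV[R]_N) : Prop :=
  forall t,
  [/\ u t = rowwise (eta t) r a,
      ubar t = u t - \sum_(s < t) d t s *: r s
    & r t = W *m u t - \sum_(s < t.+1) c t s *: ubar s].

End Algorithms.

Section LimitingCoefficients.
Variable R : realType.

Definition compactly_supported (mu : probability (measurableTypeR R) R) :=
  exists2 K : set R, compact K & mu (~` K) = 0%E.

Section Spectral.
Variable mu : probability (measurableTypeR R) R.

Fixpoint Hpol (n : nat) (l : R) : R :=
  if n is m.+1 then l * Hpol m l - \int[mu]_z (z * Hpol m z) else 1.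

(* Meant for [1 <= n]. *)
Definition gamma (n : nat) : R := \int[mu]_z (z * Hpol n.-1 z).

Variable d : nat -> nat -> R.

Definition Phi (t : nat) : 'M[R]_t :=
  \matrix_(j, i) (if (i < j)%N then d j i else 0).

Definition c_spec (c : nat -> nat -> R) : Prop :=
  forall t (s i : 'I_t), (i <= s)%N ->
    c s i = (\sum_(j < t) gamma j.+1 *: Phi t ^+ j) s i.

Definition Gmx (t : nat) (l : R) : 'M[R]_t :=
  \sum_(i < t) Hpol i.+1 l *: Phi t ^+ i.

Definition Sigma (Delta : nat -> nat -> R) (t : nat) : 'M[R]_t :=
  \matrix_(i, j)
    \int[mu]_l (Gmx t l *m (\matrix_(p, q) Delta p q) *m (Gmx t l)^T) i j.

End Spectral.

Definition mutually_independent dT (T : measurableType dT)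
    (P : probability T R) n (Z : 'I_n -> {RV P >-> R}) : Prop :=
  forall B : 'I_n -> set R, (forall i, measurable (B i)) ->
    P (\bigcap_i Z i @^-1` B i) = (\prod_i fine (P (Z i @^-1` B i)))%:E.

(* A centered Gaussian vector is a linear image [L Z] of a vector [Z] of
   independent standard normal variables; its covariance is [L L^T], which may
   be singular. *)
Definition centered_gaussian dT (T : measurableType dT) (P : probability T R)
    n (S : 'M[R]_n) (X : 'I_n -> {RV P >-> R}) : Prop :=
  exists m (L : 'M[R]_(n, m)) (Z : 'I_m -> {RV P >-> R}),
  [/\ forall j (B : set R), measurable B ->
        distribution P (Z j) B = normal_prob 0 1 B,
      mutually_independent Z,
      L *m L^T = S
    & {ae P, forall w, forall i, X i w = \sum_j L i j * Z j w}].

Section StateEvolution.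
Variables (k : nat) (dA : measure_display) (TA : measurableType dA).
Variables (PA : probability TA R) (A : 'I_k -> {RV PA >-> R}).

Definition Ubar (eta : forall t, nonlin R k t) (d : nat -> nat -> R) (t : nat)
    (r : nat -> R) (a : 'rV[R]_k) : R :=
  eta t (\row_(s < t) r s, a) - \sum_(s < t) d t s * r s.

(* [d t] and the entries of [Delta] with an index equal to [t] are determined by
   the joint law of [X_0, ..., X_(t-1)] and [A]; [Sigma mu d Delta t], hence this
   law, only involves [d s _] and [Delta s _] for [s < t].
   The Gaussian vector [(X_0, ..., X_(t-1))] lives on [T] and [A] on [TA]:
   working under the product measure makes them independent.  Being equal to
   [_%:E], the expectations are finite. *)
Definition state_evolution (mu : probability (measurableTypeR R) R)
    (eta : forall t, nonlin R k t) (d Delta : nat -> nat -> R) (t : nat) : Prop :=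
  exists dT (T : measurableType dT) (P : probability T R)
    (X : nat -> {RV P >-> R}),
  let Q : probability (T * TA)%type R := (P \x PA)%E in
  let r (w : T * TA) (s : nat) : R := X s w.1 in
  let a (w : T * TA) : 'rV[R]_k := \row_j A j w.2 in
  [/\ centered_gaussian (Sigma mu d Delta t) (fun i : 'I_t => X i),
      forall i : 'I_t,
        'E_Q[(fun w => partial i (eta t) (\row_(s < t) r w s, a w))%R]%E
        = (d t i)%:E
    & forall i j, (i <= t)%N -> (j <= t)%N ->
        'E_Q[(fun w => Ubar eta d i (r w) (a w) * Ubar eta d j (r w) (a w))%R]%E
        = (Delta i j)%:E].

Definition limiting_coefficients (mu : probability (measurableTypeR R) R)
    (eta : forall t, nonlin R k t) (c d : nat -> nat -> R) : Prop :=
  c_spec mu d c /\ exists Delta, forall t, state_evolution mu eta d Delta t.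

End StateEvolution.

End LimitingCoefficients.

(* Main.v *)
From HB Require Import structures.
From mathcomp Require Import measurable_realfun ring lra.
Require Import Defs.

(* Solving r_t = W u_t - sum_s c_(t,s) ubar_s for W u_t shows that the GFOM
   iterates are obtained from the r's by x_t = r_t + sum_s c_(t,s) ubar_s +
   psi_t(x_1, ..., x_(t-1)), provided that u_t = phi_t(x_1, ..., x_(t-1)); this
   defines eta_t and the post-processing functions recursively from the
   coefficients d_(s,i) with s < t.
   The coefficients are then built row by row together with a Cholesky factor L
   of the covariance of (R_1, R_2, ...): with R_i = sum_j L_(i,j) Z_j for i.i.d.
   standard normal Z_j, row t of d only involves the rows s < t of d and L, and
   row t of L exists because the covariance, an average of G Delta G^T with Delta
   a matrix of second moments, is positive semidefinite. As L is lower triangular,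
   enlarging t only adds new variables Z_j, so the moments computed at different
   times agree. *)

Set Implicit Arguments.
Unset Strict Implicit.
Unset Printing Implicit Defensive.

Local Open Scope classical_set_scope.
Local Open Scope ring_scope.

(** * Strong recursion *)

Section StrongRecursion.
Variables (T : Type) (x0 : T).

Section Srec.
Variable F : nat -> (nat -> T) -> T.

(** [history n] tabulates the solution below [n]; its values from [n] on are junk that a local [F]
    never reads. *)
Fixpoint history (n : nat) : nat -> T :=
  if n is m.+1 then
    fun i => if (i < m)%N then history m i else F m (history m)
  else fun=> x0.

Definition srec (n : nat) : T := F n (history n).

Lemma historyE n i : (i < n)%N -> history n i = srec i.
Proof.
elim: n => // n IHn /=; rewrite ltnS leq_eqVlt => /orP[/eqP->|lt_in].
  by rewrite ltnn.
by rewrite lt_in IHn.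
Qed.

Hypothesis F_local : forall n h h',
  (forall i, (i < n)%N -> h i = h' i) -> F n h = F n h'.

Lemma srecE n : srec n = F n srec.
Proof. by apply: F_local => i; exact: historyE. Qed.

End Srec.

Definition update (h : nat -> T) (n : nat) (y : T) : nat -> T :=
  fun i => if i == n then y else h i.

(** Choice with default [x0], so that the recursion is defined on every history, including those
    that violate the invariant. *)
Definition pick_prop (P : T -> Prop) : T :=
  if pselect (exists y, P y) is left e then projT1 (cid e) else x0.

Lemma pick_propP (P : T -> Prop) : (exists y, P y) -> P (pick_prop P).
Proof. by rewrite /pick_prop; case: pselect => // e _; case: cid. Qed.

(** Dependent choice in which the [n]-th term may depend on all earlier ones. As [Inv n] reads only
    the terms up to [n], later choices preserve it. *)
Lemma strong_choice (Inv : nat -> (nat -> T) -> Prop) :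
  (forall n h h', (forall i, (i <= n)%N -> h i = h' i) -> Inv n h -> Inv n h') ->
  (forall n h, (forall m, (m < n)%N -> Inv m h) ->
     exists y, Inv n (update h n y)) ->
  exists h, forall n, Inv n h.
Proof.
move=> Inv_local Inv_ext.
pose F n h := pick_prop (fun y => Inv n (update h n y)).
have F_local n h h' : (forall i, (i < n)%N -> h i = h' i) -> F n h = F n h'.
  (* The predicates must be equal, not merely equivalent, for the same witness to be picked. *)
  move=> hh'; congr pick_prop; apply/funext => y; apply/propext.
  have E i : (i <= n)%N -> update h n y i = update h' n y i.
    by rewrite /update leq_eqVlt => /orP[/eqP->|lt_in];
       rewrite ?eqxx// hh'// (ltn_eqF lt_in).
  by split; apply: Inv_local => i le_in; rewrite E.
exists (srec F); elim/ltn_ind => n IHn.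
have /pick_propP := Inv_ext n _ IHn.
rewrite -[pick_prop _]/(F n (srec F)) -srecE//.
apply: Inv_local => i _; rewrite /update.
by case: eqP => [->|].
Qed.

End StrongRecursion.

(** * Smooth nonlinearities *)

Section Smoothness.
Variables (R : realType) (k : nat).
Implicit Types s t : nat.

(** [lipschitz] asks that all sufficiently large constants work; one explicit nonnegative constant
    is easier to add and multiply. *)
Lemma lipschitzP t (f : nonlin R k t) :
  lipschitz f <->
  exists2 M, 0 <= M & forall p q, `|f p - f q| <= M * `|p - q|.
Proof.
split=> [[M [_ Mf]]|[M M0 Mf]].
  exists (`|M| + 1) => [|p q]; first by rewrite addr_ge0.
  have /Mf/(_ (p, q)) : M < `|M| + 1 by rewrite ltr_pwDr// ler_norm.
  by apply.
exists M; split=> [|M' MM' [p q] _ /=]; first exact: num_real.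
by rewrite (le_trans (Mf p q))// ler_wpM2r// ltW.
Qed.

Lemma lipschitzD t (f g : nonlin R k t) :
  lipschitz f -> lipschitz g -> lipschitz (fun p => f p + g p : R).
Proof.
move=> /lipschitzP[M M0 Mf] /lipschitzP[M' M'0 M'g]; apply/lipschitzP.
exists (M + M') => [|p q]; first exact: addr_ge0.
rewrite opprD addrACA mulrDl (le_trans (ler_normD _ _))//.
by rewrite lerD.
Qed.

Lemma lipschitzZ t (c : R) (f : nonlin R k t) :
  lipschitz f -> lipschitz (fun p => c * f p : R).
Proof.
move=> /lipschitzP[M M0 Mf]; apply/lipschitzP.
exists (`|c| * M) => [|p q]; first exact: mulr_ge0.
by rewrite -mulrBr normrM -mulrA ler_wpM2l.
Qed.

Lemma C1D t (f g : nonlin R k t) : C1 f -> C1 g -> C1 (fun p => f p + g p : R).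
Proof.
move=> [df cf] [dg cg].
have d p : differentiable (fun p => f p + g p : R) p.
  exact: (@differentiableD _ _ _ f g p (df p) (dg p)).
split=> // v.
rewrite (_ : 'D_v _ = fun p => 'D_v f p + 'D_v g p).
  by move=> p; apply: cvgD; [exact: cf|exact: cg].
apply/funext => p; rewrite !deriveE//.
by rewrite (@diffD _ _ _ f g p (df p) (dg p)).
Qed.

Lemma C1Z t (c : R) (f : nonlin R k t) : C1 f -> C1 (fun p => c * f p : R).
Proof.
move=> [df cf].
have d p : differentiable (fun p => c * f p : R) p.
  exact: (@differentiableZ _ _ _ f c p (df p)).
split=> // v.
rewrite (_ : 'D_v _ = fun p => c * 'D_v f p).
  by move=> p; apply: cvgM; [exact: cvg_cst|exact: cf].
apply/funext => p; rewrite !deriveE//.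
by rewrite (@diffZ _ _ _ f c p (df p)).
Qed.

Lemma smooth_nonlinD t (f g : nonlin R k t) :
  smooth_nonlin f -> smooth_nonlin g ->
  smooth_nonlin (fun p => f p + g p).
Proof. by move=> [? ?] [? ?]; split; [exact: C1D|exact: lipschitzD]. Qed.

Lemma smooth_nonlinZ t (c : R) (f : nonlin R k t) :
  smooth_nonlin f -> smooth_nonlin (fun p => c * f p).
Proof. by move=> [? ?]; split; [exact: C1Z|exact: lipschitzZ]. Qed.

Lemma smooth_nonlin0 t : @smooth_nonlin R k t (fun=> 0).
Proof.
split; [split|].
- by move=> p; exact: differentiable_cst.
- move=> v; rewrite (_ : 'D_v _ = fun=> 0); first by move=> p; exact: cvg_cst.
  apply/funext => p; rewrite deriveE; last exact: differentiable_cst.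
  by rewrite (@diff_cst _ _ _ (0 : R) p).
- by apply/lipschitzP; exists 0 => // p q; rewrite subrr normr0 mul0r.
Qed.

Lemma smooth_nonlin_sum t n (f : 'I_n -> nonlin R k t) :
  (forall i, smooth_nonlin (f i)) ->
  smooth_nonlin (fun p => \sum_(i < n) f i p).
Proof.
elim: n f => [|n IHn] f sf.
  rewrite (_ : (fun _ => _) = fun=> 0); first exact: smooth_nonlin0.
  by apply/funext => p; rewrite big_ord0.
rewrite (_ : (fun _ => _) =
    fun p => (\sum_(i < n) f (widen_ord (leqnSn n) i) p) + f ord_max p).
  by apply: smooth_nonlinD => //; exact: IHn.
by apply/funext => p; rewrite big_ord_recr.
Qed.

Lemma ler_norm_entry m n (A : 'M[R]_(m, n)) i j : `|A i j| <= `|A|.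
Proof.
rewrite [leRHS]/Num.norm/= mx_normrE.
by have := le_bigmax _ (fun ij => `|A ij.1 ij.2|) (i, j).
Qed.


(** The coordinate map gets a name so that it can carry a linear structure and hence be its own
    differential. *)
Definition entry n (i : 'I_n) (x : 'rV[R]_n) : R := x ord0 i.

Let entry_linear n (i : 'I_n) : linear (entry i : _ -> R^o).
Proof. by move=> a u v; rewrite /entry !mxE. Qed.

HB.instance Definition _ n (i : 'I_n) :=
  GRing.isLinear.Build R _ R^o _ (entry i : _ -> R^o) (entry_linear i).

Lemma diff_entry n (i : 'I_n) (x : 'rV[R]_n) : 'd (entry i) x = entry i :> (_ -> _).
Proof. by rewrite (@diff_lin _ _ _ (entry i : _ -> R^o))// => y; exact: coord_continuous. Qed.

Lemma differentiable_entry n (i : 'I_n) (x : 'rV[R]_n) : differentiable (entry i) x.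
Proof. exact: differentiable_coord. Qed.

Lemma differentiable_fst (U V : normedModType R) (p : U * V) : differentiable fst p.
Proof. by apply: (@linear_differentiable _ _ _ fst) => x; exact: cvg_fst. Qed.

Lemma differentiable_snd (U V : normedModType R) (p : U * V) : differentiable snd p.
Proof. by apply: (@linear_differentiable _ _ _ snd) => x; exact: cvg_snd. Qed.

Lemma smooth_nonlin_coord t (i : 'I_t) :
  @smooth_nonlin R k t (fun p => p.1 ord0 i).
Proof.
have d p : differentiable (fun p : 'rV[R]_t * 'rV[R]_k => p.1 ord0 i) p.
  exact: (differentiable_comp (differentiable_fst p) (differentiable_entry i p.1)).
split; [split|] => //.
- move=> v; rewrite (_ : 'D_v _ = fun=> v.1 ord0 i); first by move=> p; exact: cvg_cst.
  apply/funext => p; rewrite deriveE//.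
  rewrite (diff_comp (differentiable_fst p) (differentiable_entry i p.1))/= diff_entry.
  by rewrite (@diff_lin _ _ _ fst)// => x; exact: cvg_fst.
- apply/lipschitzP; exists 1 => // p q; rewrite mul1r.
  apply: (le_trans _ (_ : `|(p - q).1| <= _)); last by rewrite le_max lexx.
  by have := ler_norm_entry (p - q).1 ord0 i; rewrite !mxE.
Qed.

Section Composition.
Variables (s t : nat) (f : nonlin R k s) (g : 'I_s -> nonlin R k t).

Let G (p : 'rV[R]_t * 'rV[R]_k) : 'rV[R]_s := \row_i g i p.

Let GE : G = \sum_(i < s) (fun p => g i p *: delta_mx ord0 i).
Proof.
apply/funext => p; rewrite fct_sumE /G [LHS]row_sum_delta.
by apply: eq_bigr => i _; rewrite mxE.
Qed.

Let differentiableG : (forall i, C1 (g i)) -> forall p, differentiable G p.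
Proof.
move=> dg p; rewrite GE; apply: differentiable_sum => i.
by apply: differentiableZl; case: (dg i) => + _; exact.
Qed.

Let diffG : (forall i, C1 (g i)) -> forall p v i,
  ('d G p v) ord0 i = 'D_v (g i) p.
Proof.
move=> C1g p v i; have dG := differentiableG C1g p.
have -> : g i = entry i \o G by apply/funext => q; rewrite /entry/= mxE.
rewrite deriveE; last exact: (differentiable_comp dG (differentiable_entry _ _)).
by rewrite (diff_comp dG (differentiable_entry _ _))/= diff_entry.
Qed.

(** The direction [('d G p v, v.2)] moves with [p], while [C1] gives continuity along fixed
    directions only; it is therefore expanded on [(delta_mx ord0 i, 0)] and [(0, v.2)]. *)
Let derive_comp : C1 f -> (forall i, C1 (g i)) -> forall v p,
  'D_v (fun p => f (G p, p.2)) p =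
  \sum_(i < s) 'D_v (g i) p * partial i f (G p, p.2) + 'D_(0, v.2) f (G p, p.2).
Proof.
move=> [df cf] C1g v p; have dG := differentiableG C1g p.
have dH : differentiable (fun p => (G p, p.2)) p.
  by apply: differentiable_pair; [exact: dG|exact: differentiable_snd].
rewrite deriveE; last exact: (differentiable_comp dH (df _)).
rewrite (diff_comp dH (df _))/= diff_pair//; last exact: differentiable_snd.
rewrite (@diff_lin _ _ _ snd)//; last by move=> x; exact: cvg_snd.
have -> : ('d G p v, v.2) =
    \sum_(i < s) 'D_v (g i) p *: (delta_mx ord0 i, 0) + (0, v.2).
  rewrite (row_sum_delta ('d G p v)); under eq_bigr do rewrite diffG//.
  elim/big_rec2 : _ => [|i x y _]; first by rewrite add0r.
  move=> E; rewrite -addrA -E; apply/pair_equal_spec; split=> //=.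
  by rewrite scaler0 add0r.
rewrite linearD linear_sum -[X in _ + X]deriveE//; congr (_ + _).
by apply: eq_bigr => i _; rewrite linearZ/= -deriveE.
Qed.

Lemma smooth_nonlin_comp : smooth_nonlin f -> (forall i, smooth_nonlin (g i)) ->
  @smooth_nonlin R k t (fun p => f (\row_i g i p, p.2)).
Proof.
move=> [C1f /lipschitzP[M M0 Mf]] sg.
have C1g i : C1 (g i) by case: (sg i).
have dH p : differentiable (fun p => (G p, p.2)) p.
  by apply: differentiable_pair; [exact: differentiableG|exact: differentiable_snd].
split; [split|].
- move=> p; apply: (differentiable_comp (dH p)); exact: C1f.1.
- move=> v; rewrite (_ : 'D_v _ = fun p =>
      \sum_(i < s) 'D_v (g i) p * partial i f (G p, p.2) + 'D_(0, v.2) f (G p, p.2)).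
    have cH : continuous (fun p => (G p, p.2)).
      by move=> p; apply: differentiable_continuous; exact: dH.
    have cD w : continuous (fun p => 'D_w f (G p, p.2)).
      move=> p; apply: (@continuous_comp _ _ _ (fun p => (G p, p.2)) ('D_w f)).
        exact: cH.
      exact: C1f.2.
    move=> p; apply: cvgD.
      apply: cvg_big => [|i _]; first exact: add_continuous.
      apply: cvgM; first exact: (C1g i).2.
      exact: cD.
    exact: cD.
  by apply/funext => p; rewrite -derive_comp.
- have /choice[m mP] i : exists m, 0 <= m /\ forall p q, `|g i p - g i q| <= m * `|p - q|.
    by case: (sg i) => _ /lipschitzP[m m0 mg]; exists m.
  (* The sum of the [m i] controls the sup norm of the row of the [g i]; the [+ 1] covers the
     component [p.2], passed on unchanged. *)
  apply/lipschitzP; exists (M * (\sum_i m i + 1)) => [|p q].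
    by rewrite mulr_ge0// addr_ge0// sumr_ge0// => i _; case: (mP i).
  rewrite (le_trans (Mf _ _))// -mulrA ler_wpM2l// [leLHS]/Num.norm/= ge_max.
  have m0 : 0 <= \sum_i m i by rewrite sumr_ge0// => i _; case: (mP i).
  apply/andP; split; last first.
    rewrite (@le_trans _ _ `|p - q|)//; first by rewrite [leRHS]/Num.norm/= le_max lexx orbT.
    by rewrite ler_peMl// lerDr.
  rewrite [leLHS]/Num.norm/= mx_normrE; apply: bigmax_le => [|[i j] _ /=].
    by rewrite mulr_ge0// addr_ge0.
  rewrite !mxE (le_trans ((mP j).2 p q))// ler_wpM2r//.
  rewrite (bigD1 j)//= -addrA lerDl addr_ge0// sumr_ge0// => l _.
  by case: (mP l).
Qed.

End Composition.

(** The difference quotients are at most [M] times the norm of [v], and so is their limit. This is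
    what makes the expected partial derivatives finite. *)
Lemma derive_bound t (f : nonlin R k t) (v : 'rV[R]_t * 'rV[R]_k) : smooth_nonlin f ->
  exists M, forall p, `|'D_v f p| <= M.
Proof.
move=> [[df _] /lipschitzP[M M0 Mf]]; exists (M * `|v|) => p.
have dv := @diff_derivable _ _ _ _ _ v (df p).
have nv : `|(h^-1 *: (f (h *: v + p) - f p) : R)| @[h --> 0^'] --> `|'D_v f p|.
  by apply: cvg_norm; exact: dv.
rewrite -(cvg_lim _ nv)//; apply: limr_le; first by apply/cvg_ex; eexists; exact: nv.
near=> h.
have h0 : h != 0 by near: h; exact: nbhs_dnbhs_neq.
rewrite normrM normfV ler_pdivrMl ?normr_gt0// (le_trans (Mf _ _))//.
by rewrite addrK normrZ mulrCA.
Unshelve. all: by end_near.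
Qed.

End Smoothness.

(** * Measurability *)

Section Measurability.
Context {R : realType} {d : measure_display} {T : measurableType d}.

Let grid (n : nat) (r : R) : int := Num.floor (r * n.+1%:R).

Let grid_dist n r : `|r - (grid n r)%:~R / n.+1%:R| <= n.+1%:R^-1.
Proof.
have n0 : (0 : R) < n.+1%:R by [].
have /andP[lb ub] := floor_itv (r * n.+1%:R).
have -> : r - (grid n r)%:~R / n.+1%:R = (r * n.+1%:R - (grid n r)%:~R) / n.+1%:R.
  by rewrite mulrBl mulfK ?gt_eqF.
rewrite normrM normfV (gtr0_norm n0) ler_piMl ?invr_ge0 ?(ltW n0)//.
rewrite ger0_norm ?subr_ge0// lerBlDl.
by rewrite ltW//; move: ub; rewrite intrD.
Qed.

Let measurable_grid n (f : T -> R) (z : int) : measurable_fun setT f ->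
  measurable [set w | grid n (f w) = z].
Proof.
move=> mf.
have -> : [set w | grid n (f w) = z] =
    setT `&` f @^-1` ([set r | z%:~R <= r * n.+1%:R < (z + 1)%:~R]).
  rewrite setTI; apply/seteqP; split => w /=.
    by move=> <-; exact: floor_itv.
  by move=> H; apply/eqP; rewrite /grid floor_eq.
apply: mf => //.
have n0 : (0 : R) < n.+1%:R by [].
rewrite (_ : mkset _ = [set` `[z%:~R / n.+1%:R, (z + 1)%:~R / n.+1%:R[])//.
by apply/seteqP; split=> r /=; rewrite in_itv/= ler_pdivrMr// ltr_pdivlMr.
Qed.

(* A continuous function of several measurable variables is the pointwise limit
   of its values at the variables rounded to the grid Z / (n + 1), and these
   take countably many values. *)
Lemma measurable_fun_continuous_rows (t k : nat) (F : nonlin R k t)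
    (x : 'I_t -> T -> R) (a : 'I_k -> T -> R) : continuous F ->
  (forall i, measurable_fun setT (x i)) ->
  (forall j, measurable_fun setT (a j)) ->
  measurable_fun setT (fun w => F (\row_i x i w, \row_j a j w)).
Proof.
move=> cF mx ma.
pose rnd n m (v : 'rV[R]_m) : 'rV[int]_m := map_mx (grid n) v.
pose val n m (v : 'rV[int]_m) : 'rV[R]_m := map_mx (fun z => z%:~R / n.+1%:R) v.
pose h n w := F (val n _ (rnd n _ (\row_i x i w)), val n _ (rnd n _ (\row_j a j w))).
apply: (@measurable_fun_cvg _ _ _ _ h) => [n|w _].
- move=> _ B mB; rewrite setTI.
  have -> : h n @^-1` B = \bigcup_(z : 'rV[int]_t * 'rV[int]_k)
     ([set w | B (F (val n _ z.1, val n _ z.2))] `&`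
      ((\bigcap_(i in [set: 'I_t]) [set w | grid n (x i w) = z.1 ord0 i]) `&`
       (\bigcap_(j in [set: 'I_k]) [set w | grid n (a j w) = z.2 ord0 j]))).
    apply/seteqP; split => w /=.
      move=> Bw; exists (rnd n _ (\row_i x i w), rnd n _ (\row_j a j w)) => //.
      by split=> //; split=> i _ /=; rewrite !mxE.
    move=> [[z1 z2] _ /= [Bz [z1E z2E]]].
    have E1 : rnd n _ (\row_i x i w) = z1.
      by apply/rowP => i; rewrite !mxE; exact: z1E.
    have E2 : rnd n _ (\row_j a j w) = z2.
      by apply/rowP => j; rewrite !mxE; exact: z2E.
    by rewrite /preimage/= /h E1 E2.
  apply: countable_bigcupT_measurable => [|z]; first exact: countableP.
  apply: measurableI.
    case: (pselect (B (F (val n _ z.1, val n _ z.2)))) => Bz.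
      by rewrite (_ : mkset _ = setT)//; apply/seteqP; split.
    by rewrite (_ : mkset _ = set0)//; apply/seteqP; split.
  apply: measurableI; apply: fin_bigcap_measurable => //= i _;
    exact: measurable_grid.
- rewrite /h; apply: (cvg_comp _ F); last exact: cF.
  have rnd_cvg m (v : 'rV[R]_m) : val n _ (rnd n _ v) @[n --> \oo] --> v.
    apply/cvgrPdist_le => e e0; near=> n.
    rewrite [leLHS]/Num.norm/= mx_normrE; apply: bigmax_le => [|[i j] _ /=].
      exact: ltW.
    rewrite !mxE (le_trans (grid_dist _ _))//.
    near: n; have := @cvg_harmonic R => /cvgr0Pnorm_le/(_ _ e0).
    by apply: filterS => n; rewrite /harmonic/= ger0_norm.
  by apply: (cvg_pair (rnd_cvg _ _) (rnd_cvg _ _)).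
Unshelve. all: by end_near.
Qed.

End Measurability.

(** * Sequences of independent normal variables *)

Section NormalMoments.
Context {R : realType}.
Local Notation mu := (@lebesgue_measure R).

(** The Radon-Nikodym derivative of the normal law and [normal_pdf] have the same integral over
    every measurable set, hence agree almost everywhere. *)
Lemma ge0_integral_normal_prob (m s : R) (f : R -> \bar R) :
  measurable_fun [set: R] f -> (forall x, (0 <= f x)%E) ->
  (\int[normal_prob m s]_x f x = \int[mu]_x (f x * (normal_pdf m s x)%:E))%E.
Proof.
move=> mf f0; have dom := normal_prob_dominates m s.
rewrite -(Radon_Nikodym_SigmaFinite.change_of_variables dom)//.
have mrn := measurable_int _ (Radon_Nikodym_SigmaFinite.f_integrable dom).
have mpdf : measurable_fun [set: R] (fun x => (normal_pdf m s x)%:E).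
  by apply/measurable_EFinP; exact: measurable_normal_pdf.
apply: ae_eq_integral => //; [exact: emeasurable_funM|exact: emeasurable_funM|].
apply: ae_eqe_mul2l; apply: integral_ae_eq => //=.
- exact: Radon_Nikodym_SigmaFinite.f_integrable.
- by move=> E _ mE; rewrite -Radon_Nikodym_SigmaFinite.f_integral.
Qed.

Lemma Lfun2P {d} {T : measurableType d} (P : {measure set T -> \bar R}) (f : T -> R) :
  f \in Lfun P 2%:E <-> measurable_fun [set: T] f /\ (\int[P]_x (f x ^+ 2)%:E < +oo)%E.
Proof.
split=> [f2|[mf f2]].
  split; first by move: f2; rewrite inE => /andP[/[!inE]].
  exact: integrable_lty (Lfun2_integrable_sqr f2).
rewrite inE; apply/andP; split; rewrite inE//= /finite_norm unlock poweR_lty//.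
apply: le_lt_trans f2; rewrite le_eqVlt; apply/orP; left; apply/eqP.
by apply: eq_integral => x _ /=; rewrite powR_mulrn// -normrX ger0_norm ?sqr_ge0.
Qed.

(** Since exp(-x^2/2) is the square of exp(-x^2/4) and x^2 exp(-x^2/4) <= 4, the integrand is
    dominated by a multiple of the density of variance 2. *)
Lemma integral_normal_sqr : (\int[normal_prob (0 : R) 1]_x (x ^+ 2)%:E < +oo)%E.
Proof.
rewrite ge0_integral_normal_prob//; first last.
- by move=> x; rewrite lee_fin sqr_ge0.
- by apply/measurable_EFinP; exact: measurable_funX.
pose s : R := Num.sqrt 2.
have s0 : s != 0 by rewrite gt_eqF// sqrtr_gt0.
have s2 : s ^+ 2 = 2 by rewrite sqr_sqrtr.
(* The bound 4 times the ratio of the normalising constants for the standard deviations 1 and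
   [s]. *)
pose C := 4 * normal_peak 1 / normal_peak s.
apply: (@le_lt_trans _ _ (\int[mu]_x (C%:E * (normal_pdf 0 s x)%:E))%E).
  apply: ge0_le_integral => //=.
  - by move=> x _; rewrite mule_ge0// lee_fin ?sqr_ge0// normal_pdf_ge0.
  - apply/measurable_EFinP; apply: measurable_funM; last exact: measurable_normal_pdf.
    exact: measurable_funX.
  - by apply/measurable_EFinP; apply: measurable_funM => //; exact: measurable_normal_pdf.
  move=> x _; rewrite -!EFinM lee_fin !normal_pdfE ?oner_eq0// /normal_fun subr0 s2.
  set p1 := normal_peak 1; set e2 := expR (- x ^+ 2 / (2 *+ 2)).
  have -> : expR (- x ^+ 2 / (1 ^+ 2 *+ 2)) = e2 * e2.
    by rewrite -expRD; congr expR; field.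
  have -> : C * (normal_peak s * e2) = 4 * (p1 * e2).
    by rewrite /C -!mulrA mulKf// gt_eqF// normal_peak_gt0.
  have -> : x ^+ 2 * (p1 * (e2 * e2)) = (x ^+ 2 * e2) * (p1 * e2) by ring.
  rewrite ler_wpM2r ?mulr_ge0 ?normal_peak_ge0 ?expR_ge0//.
  rewrite /e2 mulNr expRN ler_pdivrMr ?expR_gt0//.
  have := expR_ge1Dx (x ^+ 2 / (2 *+ 2)).
  by rewrite -(ler_pM2l (_ : 0 < 4))//; apply: le_trans; lra.
rewrite integralZl//=; last exact: integrable_normal_pdf.
by rewrite integral_normal_pdf mule1 ltry.
Qed.

End NormalMoments.

(** * Integrals against image measures and marginals of product measures *)

Section Pushforward.
Local Open Scope ereal_scope.
Context {R : realType}.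

Lemma integral_pushforward_measurable d1 d2 (X : measurableType d1)
    (Y : measurableType d2) (phi : X -> Y) (mu : {measure set X -> \bar R})
    (f : Y -> \bar R) : measurable_fun [set: X] phi -> measurable_fun [set: Y] f ->
  \int[pushforward mu phi]_y f y = \int[mu]_x f (phi x).
Proof.
move=> mphi mf; rewrite [LHS]integralE [RHS]integralE; congr (_ - _).
  rewrite ge0_integral_pushforward//; last exact: measurable_funepos.
  by rewrite preimage_setT; under [RHS]eq_integral do rewrite funepos_comp.
rewrite ge0_integral_pushforward//; last exact: measurable_funeneg.
by rewrite preimage_setT; under [RHS]eq_integral do rewrite funeneg_comp.
Qed.

Context {d1 d2 : measure_display} {T1 : measurableType d1} {T2 : measurableType d2}.
Variables (P1 : probability T1 R) (P2 : probability T2 R).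

Lemma integral_prod_fst (f : T1 -> \bar R) : measurable_fun [set: T1] f ->
  \int[P1 \x P2]_w f w.1 = \int[P1]_x f x.
Proof.
move=> mf; rewrite -(integral_pushforward_measurable _ measurable_fst)//.
apply: eq_measure_integral => A mA _.
transitivity ((P1 \x P2) (A `*` setT)); first by rewrite setXT.
by rewrite product_measure1E//= probability_setT mule1.
Qed.

Lemma integral_prod_snd (f : T2 -> \bar R) : measurable_fun [set: T2] f ->
  \int[P1 \x P2]_w f w.2 = \int[P2]_x f x.
Proof.
move=> mf; rewrite -(integral_pushforward_measurable _ measurable_snd)//.
apply: eq_measure_integral => A mA _.
transitivity ((P1 \x P2) (setT `*` A)); first by rewrite setTX.
by rewrite product_measure1E//= probability_setT mul1e.
Qed.

Context {d3 : measure_display} {T3 : measurableType d3}.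
Variable P3 : probability T3 R.

(** The image of the triple product under forgetting the middle factor agrees on rectangles with the
    product of the outer two, which determines it. The middle factor will be the last normal
    variable added. *)
Lemma integral_prod_drop2 (f : T1 * T3 -> \bar R) : measurable_fun setT f ->
  \int[(P1 \x P2) \x P3]_w f (w.1.1, w.2) = \int[P1 \x P3]_w f w.
Proof.
move=> mf.
have mphi : measurable_fun setT (fun w : (T1 * T2) * T3 => (w.1.1, w.2)).
  apply: measurable_fun_pair; last exact: measurable_snd.
  exact: (measurableT_comp measurable_fst measurable_fst).
rewrite -(integral_pushforward_measurable _ mphi)//.
apply: eq_measure_integral => A mA _; apply/esym.
apply: (@product_measure_unique _ _ _ _ _ P1 P3 (pushforward _ (mfun_Sub (mem_set mphi)))) => //.
move=> B C mB mC.
transitivity (((P1 \x P2) \x P3) ((B `*` setT) `*` C)).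
  rewrite -(_ : (fun w => (w.1.1, w.2)) @^-1` (B `*` C) = (B `*` setT) `*` C)//.
  by apply/seteqP; split=> -[[x y] z] /=; rewrite /preimage/=; tauto.
rewrite product_measure1E//=; last exact: measurableX.
by rewrite product_measure1E//= probability_setT mule1.
Qed.

End Pushforward.

(** * Finite products of the standard normal law *)

Section GaussianSpaces.
Variable R : realType.

Definition mkRV d (T : measurableType d) (P : probability T R) (f : T -> R)
  (mf : measurable_fun [set: T] f) : {RV P >-> R} := mfun_Sub (mem_set mf).

(** The underlying type grows with the number of variables; bundling it with its probability allows
    a recursion on that number. *)
Record seq_space := SeqSpace {
  ss_disp : measure_display;
  ss_type : measurableType ss_disp;
  ss_prob : probability ss_type R;
  ss_var : nat -> {RV ss_prob >-> R} }.

Let N01 : probability (measurableTypeR R) R := normal_prob (0 : R) 1.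

Let measurable_extend (S : seq_space) n i :
  measurable_fun [set: ss_type S * measurableTypeR R]
    (fun w => if i == n then w.2 else ss_var S i w.1).
Proof.
case: (i == n); first exact: measurable_snd.
exact: (@measurableT_comp _ _ _ _ _ _ (ss_var S i) _ fst).
Qed.

(** Level [n] carries independent normal variables at the indices below [n] and zero at the others;
    the base factor only provides a probability space to start from. *)
Fixpoint gauss_space (n : nat) : seq_space :=
  if n is m.+1 then
    let S := gauss_space m in
    @SeqSpace _ (ss_type S * measurableTypeR R)%type (ss_prob S \x N01)%E
      (fun i => mkRV _ (@measurable_extend S m i))
  else @SeqSpace _ (measurableTypeR R) N01 (fun=> mkRV _ (measurable_cst (0 : R))).

Lemma ss_varE n i w : ss_var (gauss_space n.+1) i w =
  if i == n then w.2 else ss_var (gauss_space n) i w.1.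
Proof. by []. Qed.

Lemma gauss_var_normal n i (B : set R) : (i < n)%N -> measurable B ->
  distribution (ss_prob (gauss_space n)) (ss_var (gauss_space n) i) B =
  normal_prob 0 1 B.
Proof.
move=> + mB; elim: n => // n IHn; rewrite ltnS leq_eqVlt => /orP[/eqP->|lt_in].
  transitivity ((ss_prob (gauss_space n) \x N01)%E (setT `*` B)).
    rewrite -(_ : ss_var (gauss_space n.+1) n @^-1` B = setT `*` B)//.
    by apply/seteqP; split=> w; rewrite /preimage/= eqxx//; tauto.
  by rewrite product_measure1E//= probability_setT mul1e.
rewrite -IHn//.
transitivity ((ss_prob (gauss_space n) \x N01)%E
    ((ss_var (gauss_space n) i @^-1` B) `*` setT)).
  rewrite -(_ : ss_var (gauss_space n.+1) i @^-1` B = _ `*` setT)//.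
  by apply/seteqP; split=> w; rewrite /preimage/= (ltn_eqF lt_in)//; tauto.
rewrite product_measure1E//=; last exact: measurable_funPTI.
by rewrite probability_setT mule1.
Qed.

(** By induction: the event is a rectangle, with the conditions on the first variables on one side
    and the condition on the last one on the other. *)
Lemma gauss_var_independent n :
  mutually_independent (fun i : 'I_n => ss_var (gauss_space n) i).
Proof.
elim: n => [|n IHn] B mB.
  rewrite big_ord0 (_ : \bigcap_i _ = setT) ?probability_setT//.
  by apply/seteqP; split=> // w _ [].
pose B' (i : 'I_n) := B (widen_ord (leqnSn n) i).
have E : \bigcap_i ss_var (gauss_space n.+1) (i : 'I_n.+1) @^-1` B i =
    (\bigcap_i ss_var (gauss_space n) (i : 'I_n) @^-1` B' i) `*` B ord_max.
  apply/seteqP; split=> w /=.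
    move=> H; split=> [i _|]; last by have := H ord_max I; rewrite /preimage/= eqxx.
    have := H (widen_ord (leqnSn n) i) I.
    by rewrite /preimage/= (ltn_eqF (ltn_ord i)).
  move=> [H1 H2] i _; rewrite /preimage/=; case: eqP => [/= ei|ni].
    by rewrite (_ : i = ord_max)//; exact: val_inj.
  have lt_in : (i < n)%N by rewrite ltn_neqAle -ltnS ltn_ord andbT; exact/eqP.
  have := H1 (Ordinal lt_in) I; rewrite /B' /preimage/=.
  by congr (B _ _); exact: val_inj.
rewrite E -[LHS]/((ss_prob (gauss_space n) \x N01)%E (_ `*` _)) product_measure1E//=; last exact: mB; last first.
  by apply: fin_bigcap_measurable => // i _; apply: measurable_funPTI; exact: mB.
rewrite IHn => [|i]; last exact: mB.
rewrite big_ord_recr EFinM; congr (_ * _)%E.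
  congr EFin; apply: eq_bigr => i _; congr fine.
  transitivity (normal_prob (0 : R) 1 (B' i)).
    by apply: gauss_var_normal; [exact: ltn_ord|exact: mB].
  by apply/esym; apply: (@gauss_var_normal n.+1); [exact: (ltn_trans (ltn_ord i))|exact: mB].
transitivity (fine (N01 (B ord_max)))%:E.
  by rewrite fineK// fin_num_measure//; exact: mB.
congr (fine _)%:E; apply/esym.
by apply: (@gauss_var_normal n.+1) => //; exact: mB.
Qed.

Lemma gauss_var_Lfun2 n i :
  (ss_var (gauss_space n) i : _ -> R) \in Lfun (ss_prob (gauss_space n)) 2%:E.
Proof.
elim: n => [|n IHn].
  exact: (@Lfun_cst _ _ R (ss_prob (gauss_space 0)) 0 2).
apply/Lfun2P; split=> //.
have [->|ni] := eqVneq i n.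
  under eq_integral do rewrite ss_varE eqxx.
  rewrite (integral_prod_snd _ _ (f := fun x : measurableTypeR R => (x ^+ 2)%:E)).
    exact: integral_normal_sqr.
  by apply/measurable_EFinP; exact: measurable_funX.
under eq_integral do rewrite ss_varE (negbTE ni).
have [mf f2] := (Lfun2P _ _).1 IHn.
rewrite (integral_prod_fst _ _ (f := fun x => (ss_var (gauss_space n) i x ^+ 2)%:E))//.
by apply/measurable_EFinP; exact: measurable_funX.
Qed.

End GaussianSpaces.

(** * Positive semidefinite covariances *)

Section SumLemmas.
Variable V : nmodType.

Lemma sum_ord_widen m n (F : nat -> V) : (m <= n)%N ->
  (forall i, (m <= i)%N -> F i = 0) -> \sum_(i < n) F i = \sum_(i < m) F i.
Proof.
move=> le_mn F0; rewrite (big_ord_widen n F le_mn) [RHS]big_mkcond/=.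
by apply: eq_bigr => i _; case: ltnP => // /F0.
Qed.

End SumLemmas.

Section Cholesky.
Variable R : realType.

Definition psd n (S : nat -> nat -> R) :=
  forall v : nat -> R, 0 <= \sum_(i < n) \sum_(j < n) v i * v j * S i j.

(** Positivity of the matrix [K = L *m L^T] bordered by [s] and [a] forces [s] into the row space of
    [K], even for singular [K]. Writing [s = w *m K], the row [l = w *m L] works and [c ^+ 2] is the
    Schur complement. *)
Lemma psd_step_mx n (L : 'M[R]_n) (s : 'rV[R]_n) (a : R) :
  (forall (u : 'rV[R]_n) (b : R), 0 <= (u *m (L *m L^T) *m u^T) ord0 ord0 + 2 * b * (s *m u^T) ord0 ord0 + b ^+ 2 * a) ->
  exists (l : 'rV[R]_n) (c : R), l *m L^T = s /\ (l *m l^T) ord0 ord0 + c ^+ 2 = a.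
Proof.
move=> psdQ; pose K := L *m L^T.
have sK : (s <= K)%MS.
  rewrite submxE; apply/eqP/rowP => j; rewrite [RHS]mxE.
  have -> : (s *m cokermx K) ord0 j = (s *m (row j (cokermx K)^T)^T) ord0 ord0.
    by rewrite !mxE; apply: eq_bigr => i _; rewrite !mxE.
  set u := row j _; set x := (s *m u^T) ord0 ord0.
  have Ku : K *m u^T = 0.
    by rewrite /u tr_row trmxK colE mulmxA mulmx_coker mul0mx.
  apply/eqP; rewrite -/x; apply: contraT => x0.
  (* On multiples of the kernel vector [u] the form is affine; this multiple gives it the value
     -1. *)
  have := psdQ ((- (a + 1) / (2 * x)) *: u) 1.
  rewrite -/K -mulmxA linearZ/= -[K *m (_ *: _)]scalemxAr Ku scaler0 mulmx0 mxE.
  rewrite -scalemxAr mxE -/x.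
  have -> : 0 + 2 * 1 * (- (a + 1) / (2 * x) * x) + 1 ^+ 2 * a = - 1 by field.
  by rewrite lerNr oppr0 ler10.
pose w := s *m pinvmx K.
have wK : w *m K = s by rewrite mulmxKpV.
pose l := w *m L.
have lL : l *m L^T = s by rewrite /l -mulmxA.
have ll : (l *m l^T) ord0 ord0 = (s *m w^T) ord0 ord0.
  by rewrite /l trmx_mul mulmxA -[w *m L *m L^T]mulmxA wK.
(* With last coordinate 1 the form is minimal at [- w], where its value is the Schur complement. *)
have := psdQ (- w) 1.
rewrite -/K mulNmx wK linearN/= !mulmxN mulNmx opprK.
rewrite (_ : (- (s *m w^T)) ord0 ord0 = - (s *m w^T) ord0 ord0); last by rewrite mxE.
move=> H.
exists l, (Num.sqrt (a - (s *m w^T) ord0 ord0)); split=> //.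
rewrite ll sqr_sqrtr; first by rewrite addrC subrK.
by move: H; lra.
Qed.

(** The bordering step for arrays indexed by naturals; the new row is supported on the indices up to
    [n], so the factor stays lower triangular. *)
Lemma cholesky_step n (L S : nat -> nat -> R) :
  (forall i j, (i < n)%N -> (j < n)%N -> \sum_(k < n) L i k * L j k = S i j) ->
  (forall i j, S i j = S j i) -> psd n.+1 S ->
  exists l : nat -> R, [/\ forall k, (n < k)%N -> l k = 0,
    forall j, (j < n)%N -> \sum_(k < n) l k * L j k = S n j
    & \sum_(k < n.+1) l k * l k = S n n].
Proof.
move=> LS Ssym Spsd.
pose Lm := \matrix_(i < n, k < n) L i k.
pose s := \row_(j < n) S n j.
have [] := @psd_step_mx n Lm s (S n n).
  (* [v] is [u] followed by [b] at index [n], the last index read by the form. *)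
  move=> u b; pose v i := if insub i is Some j then u ord0 (j : 'I_n) else b.
  have vE (i : 'I_n) : v i = u ord0 i by rewrite /v/= valK.
  have vn : v n = b by rewrite /v insubF//= ltnn.
  have E1 : (u *m (Lm *m Lm^T) *m u^T) ord0 ord0 =
      \sum_(i < n) \sum_(j < n) u ord0 i * u ord0 j * S i j.
    rewrite mxE exchange_big/=; apply: eq_bigr => j _.
    rewrite mxE big_distrl/=; apply: eq_bigr => i _.
    rewrite (_ : (Lm *m Lm^T) i j = S i j); first by rewrite mxE; ring.
    by rewrite mxE -LS//; apply: eq_bigr => k _; rewrite !mxE.
  have E2 : (s *m u^T) ord0 ord0 = \sum_(j < n) u ord0 j * S n j.
    by rewrite mxE; apply: eq_bigr => j _; rewrite !mxE mulrC.
  have := Spsd v; rewrite E1 E2 big_ord_recr/=.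
  under eq_bigr => i _.
    rewrite big_ord_recr/= vE vn.
    under eq_bigr => j _ do rewrite vE.
    over.
  rewrite big_split/= big_ord_recr/= vn; congr (0 <= _).
  rewrite -!addrA; congr (_ + _); rewrite addrA; congr (_ + _).
  rewrite -mulrA mulr_natl mulr2n mulr_sumr; congr (_ + _); apply: eq_bigr => i _.
    by rewrite Ssym; ring.
  by rewrite vE; ring.
move=> l [c [lL lc]].
exists (fun k => if insub k is Some j then l ord0 (j : 'I_n) else if k == n then c else 0).
split=> [k ltnk|j ltjn|].
- by rewrite insubF ?gtn_eqF// ltnNge ltnW.
- have := congr1 (fun M : 'rV_n => M ord0 (Ordinal ltjn)) lL; rewrite !mxE/= => <-.
  by apply: eq_bigr => k _; rewrite valK !mxE.
- rewrite big_ord_recr/= insubF ?ltnn// eqxx -lc mxE expr2; congr (_ + _).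
  by apply: eq_bigr => k _; rewrite valK !mxE.
Qed.

End Cholesky.

Section IntegralSums.
Context d (T : measurableType d) (R : realType) (mu : {measure set T -> \bar R}).

Lemma integrable_sum_ord n (f : 'I_n -> T -> R) :
  (forall i, mu.-integrable setT (EFin \o f i)) ->
  mu.-integrable setT (EFin \o (fun x => \sum_(i < n) f i x)).
Proof.
move=> intf; rewrite (_ : _ \o _ = fun x => (\sum_(i < n) (EFin \o f i) x)%E).
  by apply: integrable_sum.
by apply/funext => x; rewrite /= sumEFin.
Qed.

Lemma Rintegral_sum_ord n (f : 'I_n -> T -> R) :
  (forall i, mu.-integrable setT (EFin \o f i)) ->
  \int[mu]_x (\sum_(i < n) f i x) = \sum_(i < n) \int[mu]_x f i x.
Proof.
elim: n f => [|n IHn] f intf.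
  by under eq_Rintegral do rewrite big_ord0; rewrite big_ord0 Rintegral_cst//= mul0r.
under eq_Rintegral do rewrite big_ord_recr/=.
by rewrite RintegralD// ?IHn ?big_ord_recr//; exact: integrable_sum_ord.
Qed.

End IntegralSums.

(** * The matrices of the state evolution as infinite arrays *)

Section NatIndexed.
Context {R : realType}.
Variable mu : probability (measurableTypeR R) R.
Hypothesis hmu : compactly_supported mu.

(* The (i, j) entry of [Phi d t ^+ n], for every [t > i, j]. *)
Fixpoint Phi_pow (d : nat -> nat -> R) (n i j : nat) : R :=
  if n is m.+1 then \sum_(l < i) d i l * Phi_pow d m l j else (i == j)%:R.

(** Since [Phi] is strictly lower triangular, its powers beyond [i] vanish on row [i]: the truncated
    sum is the entry for every matrix size. [c_coef] is truncated likewise, and [Sigma_entry] by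
    triangularity of [G_entry]. *)
Definition G_entry (d : nat -> nat -> R) (i j : nat) (l : R) : R :=
  \sum_(n < i.+1) Hpol mu n.+1 l * Phi_pow d n i j.

Definition Sigma_entry (d Delta : nat -> nat -> R) (i j : nat) : R :=
  \int[mu]_l \sum_(p < i.+1) \sum_(q < j.+1)
    G_entry d i p l * Delta p q * G_entry d j q l.

Definition c_coef (d : nat -> nat -> R) (s i : nat) : R :=
  \sum_(j < s.+1) gamma mu j.+1 * Phi_pow d j s i.

Section Entries.
Variable d : nat -> nat -> R.

Lemma Phi_powE t n (i j : 'I_t) : (Phi d t ^+ n) i j = Phi_pow d n i j.
Proof.
elim: n i j => [|n IHn] i j; first by rewrite expr0 mxE.
pose F l := (if (l < i)%N then d i l else 0) * Phi_pow d n l j.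
transitivity (\sum_(l < t) F l).
  by rewrite exprS mxE; apply: eq_bigr => l _; rewrite IHn mxE.
rewrite (sum_ord_widen (ltnW (ltn_ord i))) => [|l le_il].
  by apply: eq_bigr => l _; rewrite /F ltn_ord.
by rewrite /F ltnNge le_il mul0r.
Qed.

(** Each factor moves to a strictly smaller index, so at most [i] factors can be applied from row
    [i]. *)
Lemma Phi_pow_nilpotent n i j : (i < n)%N -> Phi_pow d n i j = 0.
Proof.
elim: n i => // n IHn i lt_in /=; rewrite big1// => l _.
by rewrite IHn ?mulr0// (leq_trans (ltn_ord l)).
Qed.

Lemma Phi_pow_lower n i j : (i < j)%N -> Phi_pow d n i j = 0.
Proof.
elim: n i => [|n IHn] i lt_ij /=; first by rewrite ltn_eqF.
by rewrite big1// => l _; rewrite IHn ?mulr0// (ltn_trans (ltn_ord l)).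
Qed.

Lemma G_entry_lower i j l : (i < j)%N -> G_entry d i j l = 0.
Proof. by move=> lt_ij; rewrite /G_entry big1// => n _; rewrite Phi_pow_lower ?mulr0. Qed.

Lemma GmxE t l (i j : 'I_t) : Gmx mu d t l i j = G_entry d i j l.
Proof.
pose F n := Hpol mu n.+1 l * Phi_pow d n i j.
transitivity (\sum_(n < t) F n).
  by rewrite /Gmx summxE; apply: eq_bigr => n _; rewrite mxE Phi_powE.
rewrite (sum_ord_widen (ltn_ord i))// => n lt_in.
by rewrite /F Phi_pow_nilpotent ?mulr0.
Qed.

Lemma c_spec_c_coef : c_spec mu d (c_coef d).
Proof.
move=> t s i _; pose F n := gamma mu n.+1 * Phi_pow d n s i.
transitivity (\sum_(n < t) F n); last first.
  by rewrite summxE; apply: eq_bigr => n _; rewrite mxE Phi_powE.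
rewrite (sum_ord_widen (ltn_ord s))// => n lt_sn.
by rewrite /F Phi_pow_nilpotent ?mulr0.
Qed.

Variable Delta : nat -> nat -> R.

Lemma Sigma_entry_widen n i j : (i < n)%N -> (j < n)%N ->
  Sigma_entry d Delta i j =
  \int[mu]_l \sum_(p < n) \sum_(q < n) G_entry d i p l * Delta p q * G_entry d j q l.
Proof.
move=> lt_in lt_jn; apply: eq_Rintegral => l _.
rewrite (@sum_ord_widen _ i.+1 n (fun p => \sum_(q < n)
    G_entry d i p l * Delta p q * G_entry d j q l))// => [|p lt_ip].
  apply: eq_bigr => p _; rewrite (@sum_ord_widen _ j.+1 n (fun q =>
    G_entry d i p l * Delta p q * G_entry d j q l))// => q lt_jq.
  by rewrite [G_entry d j _ _]G_entry_lower// mulr0.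
by rewrite big1// => q _; rewrite G_entry_lower// !mul0r.
Qed.

Lemma SigmaE t (i j : 'I_t) : Sigma mu d Delta t i j = Sigma_entry d Delta i j.
Proof.
rewrite mxE (Sigma_entry_widen (ltn_ord i) (ltn_ord j)).
apply: eq_Rintegral => l _; rewrite mxE exchange_big/=.
apply: eq_bigr => q _; rewrite mxE big_distrl/=.
by apply: eq_bigr => p _; rewrite !mxE !GmxE.
Qed.

Lemma Hpol_continuous n : continuous (Hpol mu n).
Proof.
elim: n => [|n IHn] l; first exact: cvg_cst.
by apply: cvgB; [apply: cvgM; [exact: cvg_id|exact: IHn]|exact: cvg_cst].
Qed.

Lemma G_entry_continuous i j : continuous (G_entry d i j).
Proof.
move=> l; apply: cvg_big => [|n _]; first exact: add_continuous.
by apply: cvgM; [exact: Hpol_continuous|exact: cvg_cst].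
Qed.

(** [mu] is carried by a compact set, on which [f] is bounded. *)
Lemma continuous_integrable (f : R -> R) : continuous f ->
  mu.-integrable setT (EFin \o f).
Proof.
move=> cf; have [K cK muK] := hmu.
have mK : measurable K by exact: compact_measurable.
have mf : measurable_fun setT f by exact: continuous_measurable_fun.
have mEf : measurable_fun setT (EFin \o f) by exact/measurable_EFinP.
have := (@negligible_integrable _ (measurableTypeR R) _ mu setT (~` K) (EFin \o f) (measurableC mK) measurableT mEf muK).2.
apply.
rewrite setTD setCK; apply: measurable_bounded_integrable => //.
- exact: (le_lt_trans (probability_le1 mu mK) (ltry _)).
- exact: measurable_funTS.
- have [M [Mreal fM]] := compact_bounded (continuous_compact (continuous_subspaceT cf) cK).
  by exists M; split=> // N MN x Kx; apply: (fM N MN); exists x.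
Qed.

(** For fixed [l] the form of G Delta G^T at [v] is the form of [Delta] at G^T v, hence nonnegative;
    then integrate over [l]. *)
Lemma psd_Sigma_entry n : psd n Delta -> psd n (Sigma_entry d Delta).
Proof.
move=> Dpsd v.
have GDG_cont i j :
    continuous (fun l => \sum_(p < n) \sum_(q < n) G_entry d i p l * Delta p q * G_entry d j q l).
  move=> l; apply: cvg_big => [|p _]; first exact: add_continuous.
  apply: cvg_big => [|q _]; first exact: add_continuous.
  apply: cvgM; last exact: G_entry_continuous.
  by apply: cvgM; [exact: G_entry_continuous|exact: cvg_cst].
pose F i j l := v i * v j * \sum_(p < n) \sum_(q < n) G_entry d i p l * Delta p q * G_entry d j q l.
have F_cont i j : continuous (F i j).
  by move=> l; apply: cvgM; [exact: cvg_cst|exact: GDG_cont].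
have -> : \sum_(i < n) \sum_(j < n) v i * v j * Sigma_entry d Delta i j =
    \int[mu]_l \sum_(i < n) \sum_(j < n) F i j l.
  have intF i j : mu.-integrable setT (EFin \o F i j).
    exact: continuous_integrable.
  rewrite Rintegral_sum_ord// => [|i]; last exact: integrable_sum_ord.
  apply: eq_bigr => i _; rewrite Rintegral_sum_ord//.
  apply: eq_bigr => j _; rewrite (Sigma_entry_widen (ltn_ord i) (ltn_ord j)) RintegralZl//.
  apply: continuous_integrable => l; exact: GDG_cont.
apply: Rintegral_ge0 => l _.
have := Dpsd (fun p => \sum_(i < n) v i * G_entry d i p l).
congr (0 <= _); apply/esym.
transitivity (\sum_(p < n) \sum_(q < n) \sum_(i < n) \sum_(j < n)
    v i * G_entry d i p l * (v j * G_entry d j q l) * Delta p q).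
  under eq_bigr do under eq_bigr do rewrite /F mulr_sumr.
  under eq_bigr do under eq_bigr do under eq_bigr do rewrite mulr_sumr.
  under eq_bigr do rewrite exchange_big.
  rewrite exchange_big/=; apply: eq_bigr => p _.
  under eq_bigr do rewrite exchange_big.
  rewrite exchange_big/=; apply: eq_bigr => q _.
  by apply: eq_bigr => i _; apply: eq_bigr => j _; ring.
apply: eq_bigr => p _; apply: eq_bigr => q _.
rewrite /= mulr_suml mulr_suml; apply: eq_bigr => i _.
by rewrite [v i * G_entry d i p l * \sum_(_ < n) _]mulr_sumr mulr_suml; apply: eq_bigr => j _.
Qed.

End Entries.

Lemma Phi_pow_local (d d' : nat -> nat -> R) n i j :
  (forall s, (s <= i)%N -> d s = d' s) -> Phi_pow d n i j = Phi_pow d' n i j.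
Proof.
elim: n i => // n IHn i dd' /=; apply: eq_bigr => l _.
by rewrite dd'// (IHn l)// => s le_sl; apply: dd'; rewrite (leq_trans le_sl)// ltnW.
Qed.

Lemma c_coef_local (d d' : nat -> nat -> R) s i :
  (forall l, (l <= s)%N -> d l = d' l) -> c_coef d s i = c_coef d' s i.
Proof. by move=> dd'; apply: eq_bigr => j _; rewrite (Phi_pow_local _ _ dd'). Qed.

(** No later row is read, so the covariance can be computed in the course of the recursion on
    rows. *)
Lemma Sigma_entry_local (d d' D D' : nat -> nat -> R) i j :
  (forall l, (l <= maxn i j)%N -> d l = d' l) ->
  (forall p q, (p <= i)%N -> (q <= j)%N -> D p q = D' p q) ->
  Sigma_entry d D i j = Sigma_entry d' D' i j.
Proof.
move=> dd' DD'; apply: eq_Rintegral => l _.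
have G s p : (s <= maxn i j)%N -> G_entry d s p l = G_entry d' s p l.
  move=> le_s; apply: eq_bigr => n _; rewrite (@Phi_pow_local d d')// => r le_rs.
  by rewrite dd'// (leq_trans le_rs).
apply: eq_bigr => p _; apply: eq_bigr => q _.
by rewrite !G ?leq_maxl ?leq_maxr// DD'// -ltnS.
Qed.

Lemma Sigma_entryC (d D : nat -> nat -> R) i j : (forall p q, D p q = D q p) ->
  Sigma_entry d D i j = Sigma_entry d D j i.
Proof.
move=> DC; apply: eq_Rintegral => l _; rewrite exchange_big/=.
by apply: eq_bigr => p _; apply: eq_bigr => q _; rewrite DC; ring.
Qed.

End NatIndexed.

(** * Deterministic change of iterates *)

Section ChangeOfIterates.
Context {R : realType} {k : nat}.
Variable mu : probability (measurableTypeR R) R.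
Variables phi psi : forall t, nonlin R k t.
Arguments phi : clear implicits.
Arguments psi : clear implicits.
Implicit Types (d : nat -> nat -> R) (r : nat -> R) (a : 'rV[R]_k).

(** Finite rows become sequences, so that a single recursion on sequences serves all arities [t]. *)
Definition zero_ext t (v : 'rV[R]_t) (i : nat) : R :=
  if insub i is Some j then v ord0 j else 0.

Lemma zero_ext_row t r i : (i < t)%N -> zero_ext (\row_(s < t) r s) i = r i.
Proof. by move=> lt_it; rewrite /zero_ext insubT mxE. Qed.

(** The relation defining r_n, solved for x_n: [y] holds the earlier GFOM iterates and the inner
    difference is ubar_s with u_s = phi_s(y). Only [y i] with [i < n] is read, so strong recursion
    applies. *)
Definition iterate_step d r a (n : nat) (y : nat -> R) : R :=
  r n + \sum_(s < n.+1) c_coef mu d n s *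
    (phi s (\row_(i < s) y i, a) - \sum_(i < s) d s i * r i)
  + psi n (\row_(i < n) y i, a).

(* The iterate [x_n] of the GFOM as a function of the iterates [r] of RI-AMP-DF. *)
Definition gfom_iterate d r a : nat -> R := srec 0 (iterate_step d r a).

Definition eta_of d t : nonlin R k t :=
  fun p => phi t (\row_(s < t) gfom_iterate d (zero_ext p.1) p.2 s, p.2).

Arguments eta_of : clear implicits.

Definition post_of d t : nonlin R k t.+1 :=
  fun p => gfom_iterate d (zero_ext p.1) p.2 t.

Arguments post_of : clear implicits.

Lemma gfom_iterateE d r a n :
  gfom_iterate d r a n = iterate_step d r a n (gfom_iterate d r a).
Proof.
apply: srecE => {}n h h' hh'; rewrite /iterate_step.
have E s : (s <= n)%N -> \row_(i < s) h i = \row_(i < s) h' i.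
  by move=> le_sn; apply/rowP => i; rewrite !mxE hh'// (leq_trans (ltn_ord i)).
rewrite E//; congr (_ + _ + _); apply: eq_bigr => s _.
by rewrite E// -ltnS.
Qed.

Lemma gfom_iterate_local d d' r r' a n : (forall s, (s <= n)%N -> d s = d' s) ->
  (forall i, (i <= n)%N -> r i = r' i) ->
  gfom_iterate d r a n = gfom_iterate d' r' a n.
Proof.
elim/ltn_ind: n => n IHn dd' rr'; rewrite !gfom_iterateE /iterate_step.
have E s : (s <= n)%N ->
    \row_(i < s) gfom_iterate d r a i = \row_(i < s) gfom_iterate d' r' a i.
  move=> le_sn; apply/rowP => i; rewrite !mxE.
  have lt_in : (i < n)%N by rewrite (leq_trans (ltn_ord i)).
  by apply: IHn => // j le_ji; [apply: dd'|apply: rr'];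
    rewrite (leq_trans le_ji)// ltnW.
rewrite E// rr'//; congr (_ + _ + _); apply: eq_bigr => s _.
have le_sn : (s <= n)%N by rewrite -ltnS.
rewrite E// dd'// (c_coef_local _ _ dd'); congr (_ * (_ - _)).
by apply: eq_bigr => i _; rewrite rr'// (leq_trans (ltnW (ltn_ord i))).
Qed.

Lemma eta_of_row d t r a : eta_of d t (\row_(s < t) r s, a) =
  phi t (\row_(s < t) gfom_iterate d r a s, a).
Proof.
rewrite /eta_of/=; congr (phi t (_, _)); apply/rowP => s; rewrite !mxE.
apply: gfom_iterate_local => // i le_is.
by rewrite zero_ext_row// (leq_ltn_trans le_is).
Qed.

Lemma post_of_row d t r a :
  post_of d t (\row_(s < t.+1) r s, a) = gfom_iterate d r a t.
Proof. by apply: gfom_iterate_local => // i le_it; rewrite zero_ext_row. Qed.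

(** This excludes circularity: row [t] of [d] is to be the mean of the derivatives of [eta_of d t],
    which only earlier rows determine. *)
Lemma eta_of_local d d' t : (forall s, (s < t)%N -> d s = d' s) ->
  eta_of d t = eta_of d' t.
Proof.
move=> dd'; apply/funext => p; rewrite /eta_of; congr (phi t (_, _)).
apply/rowP => s; rewrite !mxE; apply: gfom_iterate_local => // i le_is.
by rewrite dd'// (leq_ltn_trans le_is).
Qed.

Lemma gfom_iterate_Ubar d r a n : gfom_iterate d r a n =
  r n + \sum_(s < n.+1) c_coef mu d n s * Ubar (eta_of d) d s r a
  + psi n (\row_(i < n) gfom_iterate d r a i, a).
Proof.
rewrite gfom_iterateE /iterate_step; congr (_ + _ + _).
by apply: eq_bigr => s _; rewrite /Ubar eta_of_row.
Qed.

Lemma Ubar_eta_local d d' s r r' a : (forall l, (l <= s)%N -> d l = d' l) ->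
  (forall i, (i < s)%N -> r i = r' i) ->
  Ubar (eta_of d) d s r a = Ubar (eta_of d') d' s r' a.
Proof.
move=> dd' rr'; rewrite /Ubar (@eta_of_local d d') => [|l /ltnW]; last exact: dd'.
congr (_ - _).
  by congr (eta_of d' s (_, _)); apply/rowP => i; rewrite !mxE rr'.
by apply: eq_bigr => i _; rewrite dd'// rr'.
Qed.

Section Smooth.
Hypothesis hphi : forall t, smooth_nonlin (phi t).
Hypothesis hpsi : forall t, smooth_nonlin (psi t).

Lemma smooth_zero_ext t i : @smooth_nonlin R k t (fun p => zero_ext p.1 i).
Proof.
have [lt_it|le_ti] := ltnP i t.
  rewrite (_ : (fun _ => _) = fun p : 'rV[R]_t * 'rV[R]_k => p.1 ord0 (Ordinal lt_it)).
    exact: smooth_nonlin_coord.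
  by apply/funext => p; rewrite /zero_ext insubT.
rewrite (_ : (fun _ => _) = fun=> 0); first exact: smooth_nonlin0.
by apply/funext => p; rewrite /zero_ext insubF// ltnNge le_ti.
Qed.

(** By strong induction: an iterate arises from coordinates and earlier iterates by sums, scalings
    and composition with [phi] and [psi]. *)
Lemma smooth_gfom_iterate d t n :
  @smooth_nonlin R k t (fun p => gfom_iterate d (zero_ext p.1) p.2 n).
Proof.
elim/ltn_ind: n => n IHn.
rewrite (_ : (fun _ => _) = fun p : 'rV[R]_t * 'rV[R]_k =>
    iterate_step d (zero_ext p.1) p.2 n (gfom_iterate d (zero_ext p.1) p.2));
  last by apply/funext => p; rewrite gfom_iterateE.
have smooth_row s (f : nonlin R k s) : smooth_nonlin f -> (s <= n)%N ->
    @smooth_nonlin R k t (fun p =>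
      f (\row_(i < s) gfom_iterate d (zero_ext p.1) p.2 i, p.2)).
  move=> sf le_sn; apply: (smooth_nonlin_comp sf) => i.
  by apply: IHn; rewrite (leq_trans (ltn_ord i)).
apply: smooth_nonlinD; last exact: (smooth_row _ _ (hpsi n) (leqnn n)).
apply: smooth_nonlinD; first exact: smooth_zero_ext.
apply: smooth_nonlin_sum => s.
have sphi : @smooth_nonlin R k t (fun p =>
    phi s (\row_(i < s) gfom_iterate d (zero_ext p.1) p.2 i, p.2)).
  by have le_sn : (s <= n)%N; [rewrite -ltnS|exact: (smooth_row _ _ (hphi s) le_sn)].
have slin : @smooth_nonlin R k t (fun p => -1 * \sum_(i < s) d s i * zero_ext p.1 i).
  apply: (smooth_nonlinZ (-1)); apply: smooth_nonlin_sum => i.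
  exact: (smooth_nonlinZ (d s i) (smooth_zero_ext t i)).
have := smooth_nonlinZ (c_coef mu d n s) (smooth_nonlinD sphi slin).
by congr smooth_nonlin; apply/funext => p; rewrite mulN1r.
Qed.

Lemma smooth_eta_of d t : smooth_nonlin (eta_of d t).
Proof.
by apply: (smooth_nonlin_comp (hphi t)) => s; exact: smooth_gfom_iterate.
Qed.

End Smooth.

(** [r] is obtained by running the algorithm, each step reading earlier iterates only. By induction
    on time phi_t(x) = u_t, so both recursions multiply [W] by the same vector. *)
Lemma RI_AMP_DF_of_GFOM d N (W : 'M[R]_N) (a : 'M[R]_(N, k)) (x : nat -> 'cV[R]_N) :
  GFOM phi psi W a x ->
  exists u ubar r : nat -> 'cV[R]_N,
    RI_AMP_DF (eta_of d) (c_coef mu d) d W a u ubar r /\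
    forall t, x t = rowwise (post_of d t) r a.
Proof.
move=> xE.
pose u (r : nat -> 'cV[R]_N) t := rowwise (eta_of d t) r a.
pose ubar (r : nat -> 'cV[R]_N) t := u r t - \sum_(s < t) d t s *: r s.
pose step n (r : nat -> 'cV[R]_N) : 'cV[R]_N := W *m u r n - \sum_(s < n.+1) c_coef mu d n s *: ubar r s.
have u_local n (r r' : nat -> 'cV[R]_N) : (forall i, (i < n)%N -> r i = r' i) -> u r n = u r' n.
  move=> rr'; apply/colP => m; rewrite !mxE; congr (eta_of d n (_, _)).
  by apply/rowP => s; rewrite !mxE rr'.
have step_local n (r r' : nat -> 'cV[R]_N) : (forall i, (i < n)%N -> r i = r' i) -> step n r = step n r'.
  move=> rr'; rewrite /step (u_local _ _ _ rr'); congr (_ - _).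
  apply: eq_bigr => s _; congr (_ *: _); rewrite /ubar.
  have lt_rr' i : (i < s)%N -> r i = r' i.
    by move=> lt_is; apply: rr'; rewrite (leq_trans lt_is)// -ltnS.
  rewrite (u_local _ _ _ lt_rr'); congr (_ - _); apply: eq_bigr => i _.
  by rewrite lt_rr'.
pose r := srec 0 step.
have rE n : r n = step n r by exact: srecE.
exists (u r), (ubar r), r; split=> [t|].
  by split=> //; rewrite rE.
suff xr t m : x t m ord0 = gfom_iterate d (fun s => r s m ord0) (row m a) t.
  by move=> t; apply/colP => m; rewrite mxE xr -(post_of_row d t (fun s => r s m ord0)).
(* The induction hypothesis covers all rows at once, since [W] mixes them. *)
elim/ltn_ind: t m => t IHt m.
have E : \row_(s < t) x s m ord0 =
    \row_(s < t) gfom_iterate d (fun s => r s m ord0) (row m a) s.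
  by apply/rowP => s; rewrite !mxE IHt.
have phiE : rowwise (phi t) x a = u r t.
  apply/colP => n; rewrite !mxE [RHS](eta_of_row d t (fun s => r s n ord0)); congr (phi t (_, _)).
  apply/rowP => s; rewrite !mxE; exact: IHt.
have ubarE s : ubar r s m ord0 =
    Ubar (eta_of d) d s (fun s => r s m ord0) (row m a).
  rewrite /Ubar /ubar !mxE summxE; congr (_ - _).
  by apply: eq_bigr => i _; rewrite mxE.
rewrite gfom_iterate_Ubar xE mxE phiE -E; congr (_ + _); last by rewrite mxE.
have -> : r t m ord0 = (W *m u r t) m ord0 -
    \sum_(s < t.+1) c_coef mu d t s * ubar r s m ord0.
  rewrite rE /step [LHS]mxE [X in _ + X]mxE summxE; congr (_ - _).
  by apply: eq_bigr => s _; rewrite mxE.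
by under eq_bigr do rewrite ubarE; rewrite subrK.
Qed.

End ChangeOfIterates.

(** * Limiting coefficients *)

Section SquareIntegrable.
Context {R : realType} d (T : measurableType d) (P : probability T R).
Implicit Types f g : T -> R.

Let one_le2 : (1 <= 2%:E :> \bar R)%E. Proof. by rewrite lee_fin ler1n. Qed.

Lemma Lfun2_measurable f : f \in Lfun P 2%:E -> measurable_fun setT f.
Proof. by case/Lfun2P. Qed.

Lemma Lfun2D f g : f \in Lfun P 2%:E -> g \in Lfun P 2%:E ->
  (fun w => f w + g w) \in Lfun P 2%:E.
Proof.
move=> f2 g2; have [_ /(_ 1 f g f2 g2)] := Lfun_submod_closed P one_le2.
by rewrite scale1r.
Qed.

Lemma Lfun2Z c f : f \in Lfun P 2%:E -> (fun w => c * f w) \in Lfun P 2%:E.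
Proof.
move=> f2; have [z2 /(_ c f 0 f2 z2)] := Lfun_submod_closed P one_le2.
by rewrite addr0.
Qed.

Lemma Lfun2_cst (c : R) : (fun _ : T => c) \in Lfun P 2%:E.
Proof. exact: (@Lfun_cst _ _ R P c 2). Qed.

Lemma Lfun2_sum n (f : 'I_n -> T -> R) : (forall i, f i \in Lfun P 2%:E) ->
  (fun w => \sum_(i < n) f i w) \in Lfun P 2%:E.
Proof.
elim: n f => [|n IHn] f f2.
  by rewrite (_ : (fun _ => _) = fun=> 0) ?Lfun2_cst//; apply/funext => w; rewrite big_ord0.
rewrite (_ : (fun _ => _) = fun w =>
    \sum_(i < n) f (widen_ord (leqnSn n) i) w + f ord_max w).
  by apply: Lfun2D => //; exact: IHn.
by apply/funext => w; rewrite big_ord_recr.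
Qed.

Lemma Lfun2_dom f g : measurable_fun setT f -> (forall w, `|f w| <= `|g w|) ->
  g \in Lfun P 2%:E -> f \in Lfun P 2%:E.
Proof.
move=> mf fg /Lfun2P[mg g2]; apply/Lfun2P; split=> //.
apply: le_lt_trans g2; apply: ge0_le_integral => //.
- by move=> w _; rewrite lee_fin sqr_ge0.
- by apply/measurable_EFinP; exact: measurable_funX.
- by apply/measurable_EFinP; exact: measurable_funX.
- by move=> w _; rewrite lee_fin -[leLHS]real_normK ?num_real// -[leRHS]real_normK ?num_real// lerXn2r ?nnegrE.
Qed.

Lemma Lfun2_norm f : f \in Lfun P 2%:E -> (fun w => `|f w|) \in Lfun P 2%:E.
Proof.
move=> f2; apply: (Lfun2_dom _ _ f2); last by move=> w; rewrite normr_id.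
exact: (measurableT_comp _ (Lfun2_measurable f2)).
Qed.

(** A Lipschitz function grows at most linearly, hence is dominated by the square-integrable [g]. *)
Lemma Lfun2_smooth t k (F : nonlin R k t) (x : 'I_t -> T -> R) (a : 'I_k -> T -> R) :
  smooth_nonlin F -> (forall i, x i \in Lfun P 2%:E) -> (forall j, a j \in Lfun P 2%:E) ->
  (fun w => F (\row_i x i w, \row_j a j w)) \in Lfun P 2%:E.
Proof.
move=> [[dF _] /lipschitzP[M M0 MF]] x2 a2.
pose g w := `|F 0| + M * (\sum_i `|x i w| + \sum_j `|a j w|).
have g2 : g \in Lfun P 2%:E.
  apply: (Lfun2D (Lfun2_cst _)); apply: Lfun2Z; apply: Lfun2D;
    by apply: Lfun2_sum => i; exact: Lfun2_norm.
apply: (Lfun2_dom _ _ g2).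
  apply: measurable_fun_continuous_rows => [p|i|j]; try exact: Lfun2_measurable.
  exact: (differentiable_continuous (dF p)).
have sum0 n (y : 'I_n -> R) : 0 <= \sum_i `|y i|.
  by apply: sumr_ge0 => i _; exact: normr_ge0.
have row_le n (y : 'I_n -> R) : `|\row_i y i| <= \sum_i `|y i|.
  rewrite [leLHS]/Num.norm/= mx_normrE; apply: bigmax_le => [|[i j] _ /=]; first exact: sum0.
  by rewrite mxE (bigD1 j)//= lerDl; apply: sumr_ge0 => l _; exact: normr_ge0.
move=> w; rewrite [leRHS]ger0_norm; last first.
  by rewrite addr_ge0// mulr_ge0// addr_ge0.
rewrite -[X in `|X|](subrK (F 0)) (le_trans (ler_normD _ _))// addrC lerD2l.
rewrite (le_trans (MF _ _))// ler_wpM2l// subr0 [leLHS]/Num.norm/= ge_max.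
by apply/andP; split=> /=; rewrite (le_trans (row_le _ _))// ?lerDl ?lerDr; exact: sum0.
Qed.

Lemma expectation_sum_ord n (f : 'I_n -> T -> R) : (forall i, f i \in Lfun P 1) ->
  fine 'E_P[(fun w => \sum_(i < n) f i w)%R] = \sum_(i < n) fine 'E_P[f i].
Proof.
move=> f1; rewrite unlock.
by apply: Rintegral_sum_ord => i; apply/Lfun1_integrable.
Qed.

End SquareIntegrable.

(** * Expectations over Gaussian variables and independent side information *)

Section Expectations.
Context {R : realType} {k : nat} {dA : measure_display} {TA : measurableType dA}.
Variables (PA : probability TA R) (A : 'I_k -> {RV PA >-> R}).
Hypothesis hA : forall j, (A j : TA -> R) \in Lfun PA 2%:E.
Implicit Types (L : nat -> nat -> R).

Let S n := gauss_space R n.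
Let Q n : probability (ss_type (S n) * TA)%type R := (ss_prob (S n) \x PA)%E.

Let measurable_gauss_comb L n i : measurable_fun [set: ss_type (S n)]
  (fun w => \sum_(j < i.+1) L i j * ss_var (S n) j w).
Proof.
apply: Lfun2_measurable; apply: Lfun2_sum => j; apply: Lfun2Z.
exact: gauss_var_Lfun2.
Qed.

(** The sum stops at [i], not at the level [n], so that R_i has the same formula at every level
    above [i]. *)
Definition gauss_comb L n (i : nat) : {RV ss_prob (S n) >-> R} :=
  mkRV _ (@measurable_gauss_comb L n i).

Definition side_info (w : TA) : 'rV[R]_k := \row_j A j w.

Definition observe L n (f : (nat -> R) -> 'rV[R]_k -> R) (w : ss_type (S n) * TA) : R :=
  f (gauss_comb L n ^~ w.1) (side_info w.2).

Definition expect L n f : \bar R := 'E_(Q n)[observe L f].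

Lemma Lfun2_fst n (f : ss_type (S n) -> R) : f \in Lfun (ss_prob (S n)) 2%:E ->
  (fun w => f w.1) \in Lfun (Q n) 2%:E.
Proof.
move=> /Lfun2P[mf f2]; apply/Lfun2P; split.
  exact: (measurableT_comp mf measurable_fst).
rewrite (integral_prod_fst _ _ (f := fun x => (f x ^+ 2)%:E))//.
by apply/measurable_EFinP; exact: measurable_funX.
Qed.

Lemma Lfun2_snd n (f : TA -> R) : f \in Lfun PA 2%:E ->
  (fun w => f w.2) \in Lfun (Q n) 2%:E.
Proof.
move=> /Lfun2P[mf f2]; apply/Lfun2P; split.
  exact: (measurableT_comp mf measurable_snd).
rewrite (integral_prod_snd _ _ (f := fun x => (f x ^+ 2)%:E))//.
by apply/measurable_EFinP; exact: measurable_funX.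
Qed.

Lemma Lfun2_gauss_comb L n i : (fun w => gauss_comb L n i w.1) \in Lfun (Q n) 2%:E.
Proof.
apply: (@Lfun2_fst n (gauss_comb L n i)); apply: Lfun2_sum => j; apply: Lfun2Z.
exact: gauss_var_Lfun2.
Qed.

Lemma Lfun2_observe_smooth L n t (F : nonlin R k t) : smooth_nonlin F ->
  @observe L n (fun r a => F (\row_(s < t) r s, a)) \in Lfun (Q n) 2%:E.
Proof.
move=> sF; apply: (Lfun2_smooth (x := fun i w => gauss_comb L n i w.1)
  (a := fun j w => A j w.2) sF) => i; first exact: Lfun2_gauss_comb.
exact: Lfun2_snd.
Qed.

Lemma measurable_observe_continuous L n t (F : nonlin R k t) : continuous F ->
  measurable_fun setT (@observe L n (fun r a => F (\row_(s < t) r s, a))).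
Proof.
move=> cF; apply: (measurable_fun_continuous_rows (x := fun i w => gauss_comb L n i w.1)
  (a := fun j w => A j w.2) cF) => i; apply: Lfun2_measurable.
  exact: Lfun2_gauss_comb.
exact: Lfun2_snd.
Qed.

Lemma Lfun2_observe_Ubar L n (eta : forall t, nonlin R k t) d s :
  smooth_nonlin (eta s) -> @observe L n (Ubar eta d s) \in Lfun (Q n) 2%:E.
Proof.
move=> se.
have sl : @smooth_nonlin R k s (fun p => -1 * \sum_(i < s) d s i * p.1 ord0 i).
  apply: (smooth_nonlinZ (-1)); apply: smooth_nonlin_sum => i.
  exact: (smooth_nonlinZ (d s i) (@smooth_nonlin_coord R k s i)).
rewrite (_ : observe _ _ = @observe L n (fun r a => eta s (\row_(i < s) r i, a) +
    -1 * \sum_(i < s) d s i * (\row_(i < s) r i) ord0 i)).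
  exact: (Lfun2_observe_smooth L n (smooth_nonlinD se sl)).
apply/funext => w; rewrite /observe /Ubar mulN1r; congr (_ - _).
by apply: eq_bigr => i _; rewrite mxE.
Qed.

(** The partial derivative is continuous, hence measurable, and bounded because [F] is Lipschitz. *)
Lemma Lfun1_observe_partial L n t (F : nonlin R k t) (i : 'I_t) : smooth_nonlin F ->
  @observe L n (fun r a => partial i F (\row_(s < t) r s, a)) \in Lfun (Q n) 1.
Proof.
move=> sF; have [M FM] := derive_bound (delta_mx ord0 i, 0) sF.
apply/Lfun1_integrable; apply: measurable_bounded_integrable => //.
- exact: le_lt_trans (probability_le1 (Q n) measurableT) (ltry _).
- by apply: measurable_observe_continuous; case: sF => -[_ cF] _; exact: cF.
- by exists M; split=> [|N MN w _]; [exact: num_real|exact: le_trans (FM _) (ltW MN)].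
Qed.

Lemma observe_local L L' n t f w :
  (forall i, (i < t)%N -> L i = L' i) ->
  (forall r r' a, (forall i, (i < t)%N -> r i = r' i) -> f r a = f r' a) ->
  @observe L n f w = @observe L' n f w.
Proof.
move=> LL' f_local; apply: f_local => i lt_it.
by rewrite /gauss_comb/= /mkRV/= LL'.
Qed.

Lemma expect_local L L' n f : (forall i, (i < n)%N -> L i = L' i) ->
  (forall r r' a, (forall i, (i < n)%N -> r i = r' i) -> f r a = f r' a) ->
  expect L n f = expect L' n f.
Proof.
move=> LL' f_local; rewrite /expect; congr (expectation _ _); apply/funext => w.
exact: observe_local f_local.
Qed.

Lemma expect_row_local L L' n (F : nonlin R k n) :
  (forall i, (i < n)%N -> L i = L' i) ->
  expect L n (fun r a => F (\row_(s < n) r s, a)) =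
  expect L' n (fun r a => F (\row_(s < n) r s, a)).
Proof.
move=> LL'; apply: expect_local => // r r' a rr'; congr (F (_, _)).
by apply/rowP => s; rewrite !mxE rr'.
Qed.

(** Each further level adds a normal factor that [f] does not see and that integrates out; hence
    moments computed at different times agree. *)
Lemma expect_stable L t n f : (t <= n)%N ->
  (forall m, measurable_fun setT (@observe L m f)) ->
  (forall r r' a, (forall i, (i < t)%N -> r i = r' i) -> f r a = f r' a) ->
  expect L n f = expect L t f.
Proof.
move=> + mf f_local; elim: n => [|n IHn]; first by rewrite leqn0 => /eqP->.
rewrite leq_eqVlt => /orP[/eqP->//|lt_tn]; rewrite -IHn//.
rewrite /expect unlock.
rewrite -(@integral_prod_drop2 _ _ _ _ _ (ss_prob (S n)) (normal_prob (0 : R) 1) _ _ PA (fun w => (observe L f w)%:E)).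
  apply: eq_integral => w _; congr EFin; apply: f_local => i lt_it.
  apply: eq_bigr => j _; congr (_ * _).
  (* As j <= i < t <= n, the new variable, of index [n], does not occur. *)
  rewrite ss_varE ltn_eqF// (leq_ltn_trans (leq_ord j))//.
  by rewrite (leq_trans lt_it).
by apply/measurable_EFinP; exact: mf.
Qed.

End Expectations.

(** * Row-by-row construction of the coefficients *)

Section Coefficients.
Context {R : realType} {k : nat}.
Variable mu : probability (measurableTypeR R) R.
Hypothesis hmu : compactly_supported mu.
Context {dA : measure_display} {TA : measurableType dA}.
Variables (PA : probability TA R) (A : 'I_k -> {RV PA >-> R}).
Hypothesis hA : forall j, (A j : TA -> R) \in Lfun PA 2%:E.
Variables phi psi : forall t, nonlin R k t.
Arguments phi : clear implicits.
Arguments psi : clear implicits.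
Hypothesis hphi : forall t, smooth_nonlin (phi t).
Hypothesis hpsi : forall t, smooth_nonlin (psi t).
Implicit Types d L : nat -> nat -> R.

Let eta d := eta_of mu phi psi d.
Arguments eta : clear implicits.
Let ub d s := Ubar (eta d) d s.
Let ub2 d p q r a := ub d p r a * ub d q r a.

Let smooth_eta d t : smooth_nonlin (eta d t).
Proof. exact: smooth_eta_of. Qed.

(** The level is the smallest one carrying all normal variables that the two factors read. *)
Definition Delta_of d L p q : R := fine (expect A L (maxn p q) (ub2 d p q)).

Let ub2_Lfun1 d L n p q : observe A (n := n) L (ub2 d p q) \in
  Lfun (ss_prob (gauss_space R n) \x PA)%E 1.
Proof.
by apply: Lfun2_mul_Lfun1; apply: Lfun2_observe_Ubar => //; exact: smooth_eta.
Qed.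

Let ub2_local d d' p q r r' a :
  (forall l, (l <= maxn p q)%N -> d l = d' l) ->
  (forall i, (i < maxn p q)%N -> r i = r' i) ->
  ub2 d p q r a = ub2 d' p q r' a.
Proof.
move=> dd' rr'; congr (_ * _); apply: Ubar_eta_local => l lt_l;
  by [apply: dd'; rewrite leq_max lt_l ?orbT|apply: rr'; rewrite leq_max lt_l ?orbT].
Qed.

Lemma Delta_ofE d L n p q : (p <= n)%N -> (q <= n)%N ->
  expect A L n (ub2 d p q) = (Delta_of d L p q)%:E.
Proof.
move=> le_pn le_qn; rewrite fineK; last exact: (expectation_fin_num (ub2_Lfun1 _ _ _ _ _)).
apply: expect_stable => // [|m|r r' a rr'].
- by rewrite geq_max le_pn.
- by have /Lfun1_integrable/measurable_int/measurable_EFinP := ub2_Lfun1 d L m p q.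
- exact: ub2_local.
Qed.

Lemma Delta_ofC d L p q : Delta_of d L p q = Delta_of d L q p.
Proof.
rewrite /Delta_of maxnC; congr (fine (expect A L _ _)).
by apply/funext => r; apply/funext => a; rewrite /ub2 mulrC.
Qed.

(** The bound is strict for [L] but not for [d]. This fixes the order of construction: [d n], then
    the moments up to index [n], then [L n]. *)
Lemma Delta_of_local d d' L L' p q :
  (forall l, (l <= maxn p q)%N -> d l = d' l) ->
  (forall l, (l < maxn p q)%N -> L l = L' l) ->
  Delta_of d L p q = Delta_of d' L' p q.
Proof.
move=> dd' LL'; rewrite /Delta_of (_ : ub2 d p q = ub2 d' p q); last first.
  by apply/funext => r; apply/funext => a; exact: ub2_local.
by congr fine; apply: expect_local => // r r' a rr'; exact: ub2_local.
Qed.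

(** The form at [v] is the second moment of the sum of the [v i] times Ubar_i, all taken at the
    common level [n]. *)
Lemma psd_Delta_of d L n : psd n.+1 (Delta_of d L).
Proof.
move=> v.
pose V i := observe A (n := n) L (ub d i).
pose P : probability _ R := (ss_prob (gauss_space R n) \x PA)%E.
have VV1 (i j : 'I_n.+1) : (fun w => v i * v j * (V i w * V j w)) \in Lfun P 1.
  have /Lfun1_integrable/(integrableZl measurableT (v i * v j)) := ub2_Lfun1 d L n i j.
  by move=> ?; apply/Lfun1_integrable.
have VVs (i : 'I_n.+1) :
    (fun w => \sum_(j < n.+1) v i * v j * (V i w * V j w)) \in Lfun P 1.
  apply/Lfun1_integrable; apply: integrable_sum_ord => j; exact/Lfun1_integrable.
have -> : \sum_(i < n.+1) \sum_(j < n.+1) v i * v j * Delta_of d L i j =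
    fine 'E_P[(fun w => (\sum_(i < n.+1) v i * V i w) ^+ 2)%R].
  transitivity (fine 'E_P[(fun w => \sum_(i < n.+1) \sum_(j < n.+1)
      v i * v j * (V i w * V j w))%R]).
    rewrite expectation_sum_ord//; apply: eq_bigr => i _.
    rewrite expectation_sum_ord//; apply: eq_bigr => j _.
    have -> : Delta_of d L i j = fine (expect A L n (ub2 d i j)).
      by rewrite Delta_ofE// -ltnS.
    rewrite /expect unlock -RintegralZl//.
    exact/Lfun1_integrable/ub2_Lfun1.
  congr (fine (expectation _ _)); apply/funext => w; rewrite expr2 mulr_suml.
  apply: eq_bigr => i _; rewrite mulr_sumr; apply: eq_bigr => j _; ring.
by rewrite fine_ge0// expectation_ge0// => w; rewrite sqr_ge0.
Qed.

(* Row [n] of a history [h] is the pair of row [n] of the coefficients [d] and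
   row [n] of a Cholesky factor [L] of the covariance of the Gaussian vector. *)
Let row_type := ((nat -> R) * (nat -> R))%type.
Let dOf (h : nat -> row_type) s := (h s).1.
Let LOf (h : nat -> row_type) s := (h s).2.

Definition row_spec (n : nat) (h : nat -> row_type) : Prop :=
  let d := dOf h in let L := LOf h in
  [/\ forall i : 'I_n,
        expect A L n (fun r a => partial i (eta d n) (\row_(s < n) r s, a)) =
        (d n i)%:E,
      forall l, (n < l)%N -> L n l = 0
    & forall j, (j <= n)%N -> \sum_(l < n.+1) L n l * L j l =
        Sigma_entry mu d (Delta_of d L) n j].

Lemma row_spec_local n h h' : (forall i, (i <= n)%N -> h i = h' i) ->
  row_spec n h -> row_spec n h'.
Proof.
move=> hh' [dE L0 LE].
have dd' s : (s <= n)%N -> dOf h s = dOf h' s by move=> ?; rewrite /dOf hh'.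
have LL' s : (s <= n)%N -> LOf h s = LOf h' s by move=> ?; rewrite /LOf hh'.
split=> [i|l lt_nl|j le_jn]; rewrite -?dd' -?LL'//.
- rewrite -dE (_ : eta (dOf h') n = eta (dOf h) n); last first.
    by apply: eta_of_local => s /ltnW/dd' ->.
  apply: (expect_row_local A (partial i (eta (dOf h) n))) => s lt_sn.
  by rewrite LL'// ltnW.
- exact: L0.
- rewrite LE//; apply: Sigma_entry_local => [l|p q le_pn le_qj].
    by rewrite (maxn_idPl le_jn); exact: dd'.
  have le_pq : (maxn p q <= n)%N by rewrite geq_max le_pn (leq_trans le_qj).
  apply: Delta_of_local => l lt_l; first by apply: dd'; exact: leq_trans le_pq.
  by apply: LL'; rewrite ltnW// (leq_trans lt_l).
Qed.

(** [row_spec] gives the entries with [j <= i]; symmetry gives the others. *)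
Lemma cholesky_rows n h : (forall m, (m < n)%N -> row_spec m h) ->
  forall i j, (i < n)%N -> (j < n)%N ->
  \sum_(l < n) LOf h i l * LOf h j l =
  Sigma_entry mu (dOf h) (Delta_of (dOf h) (LOf h)) i j.
Proof.
move=> hn i j; wlog le_ji : i j / (j <= i)%N => [hw lt_in lt_jn|lt_in lt_jn].
  case: (leqP j i) => [|/ltnW] le_ij; first exact: hw.
  rewrite Sigma_entryC; last exact: Delta_ofC.
  by rewrite -hw//; apply: eq_bigr => l _; rewrite mulrC.
have [_ L0 <-//] := hn i lt_in.
rewrite (@sum_ord_widen _ i.+1 n (fun l => LOf h i l * LOf h j l))// => l lt_il.
by rewrite L0 ?mul0r.
Qed.

Lemma row_spec_ext n h : (forall m, (m < n)%N -> row_spec m h) ->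
  exists y, row_spec n (update h n y).
Proof.
move=> hn.
pose dn i := if insub i is Some j then
  fine (expect A (LOf h) n (fun r a => partial (j : 'I_n) (eta (dOf h) n) (\row_(s < n) r s, a)))
  else 0.
have upd_lt y i : (i < n)%N -> update h n y i = h i.
  by move=> lt_in; rewrite /update ltn_eqF.
have upd_n y : update h n y n = y by rewrite /update eqxx.
(* Row [n] of [L] is provisionally zero: the covariance up to index [n] does not read it, so it can
   be factored before the true row is known. *)
pose h1 := update h n (dn, fun=> 0).
have h1n m : (m < n)%N -> row_spec m h1.
  move=> lt_mn; apply: row_spec_local (hn m lt_mn) => i le_im.
  by rewrite /h1 upd_lt// (leq_ltn_trans le_im).
have [||l [l0 lL ll]] := cholesky_step (cholesky_rows h1n).
- by move=> i j; apply: Sigma_entryC; exact: Delta_ofC.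
- by apply: psd_Sigma_entry => //; exact: psd_Delta_of.
exists (dn, l); set h2 := update h n (dn, l).
have d12 : dOf h1 = dOf h2.
  by apply/funext => s; rewrite /dOf /h1 /h2 /update; case: eqP.
have L12 s : (s < n)%N -> LOf h1 s = LOf h2 s by move=> ?; rewrite /LOf /h1 /h2 !upd_lt.
have S12 j : (j <= n)%N ->
    Sigma_entry mu (dOf h1) (Delta_of (dOf h1) (LOf h1)) n j =
    Sigma_entry mu (dOf h2) (Delta_of (dOf h2) (LOf h2)) n j.
  move=> le_jn; rewrite d12; apply: Sigma_entry_local => // p q le_pn le_qj.
  apply: Delta_of_local => // s lt_s; apply: L12; rewrite (leq_trans lt_s)//.
  by rewrite geq_max le_pn (leq_trans le_qj).
have L2n : LOf h2 n = l by rewrite /LOf /h2 upd_n.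
split=> [i|s lt_ns|j]; rewrite ?L2n.
- have -> : dOf h2 n i = dn i by rewrite /dOf /h2 upd_n.
  rewrite /dn valK fineK; last first.
    exact/expectation_fin_num/Lfun1_observe_partial/smooth_eta.
  rewrite (_ : eta (dOf h2) n = eta (dOf h) n); last first.
    by apply: eta_of_local => s lt_sn; rewrite /dOf /h2 upd_lt.
  apply: (expect_row_local A (partial i (eta (dOf h) n))) => s lt_sn.
  by rewrite /LOf /h2 upd_lt.
- exact: l0.
- rewrite leq_eqVlt => /orP[/eqP->|lt_jn]; first by rewrite L2n ll S12.
  (* For [j < n] the added term vanishes, since row [j] of the factor is zero at index [n]. *)
  rewrite -S12 1?ltnW// -(lL _ lt_jn) big_ord_recr/= -(L12 _ lt_jn).
  have [_ L0 _] := h1n j lt_jn.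
  by rewrite L0// mulr0 addr0.
Qed.

Lemma limiting_coefficients_exist : exists d,
  limiting_coefficients A mu (eta d) (c_coef mu d) d.
Proof.
have [h hP] := strong_choice ((fun=> 0, fun=> 0) : row_type) row_spec_local row_spec_ext.
exists (dOf h); split; first exact: c_spec_c_coef.
exists (Delta_of (dOf h) (LOf h)) => t.
(* Time [t] uses the Gaussian space of level [t]; [Delta_ofE] identifies its moments with the one
   array chosen before [t]. *)
exists _, (ss_type (gauss_space R t)), (ss_prob (gauss_space R t)), (gauss_comb (LOf h) t).
split.
- exists t, (\matrix_(i < t, j < t) LOf h i j), (fun j : 'I_t => ss_var (gauss_space R t) j).
  split.
  + by move=> j B mB; exact: gauss_var_normal.
  + exact: gauss_var_independent.
  + apply/matrixP => i j; rewrite SigmaE -(@cholesky_rows t)// mxE.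
    by apply: eq_bigr => l _; rewrite !mxE.
  + apply: aeW => w i.
    have [_ L0 _] := hP i.
    rewrite (_ : gauss_comb _ _ _ _ = \sum_(j < i.+1) LOf h i j * ss_var (gauss_space R t) j w)//.
    rewrite -(@sum_ord_widen _ i.+1 t (fun j => LOf h i j * ss_var (gauss_space R t) j w))//.
      by apply: eq_bigr => j _; rewrite mxE.
    by move=> j lt_ij; rewrite L0 ?mul0r.
- by have [dE _ _] := hP t; exact: dE.
- by move=> i j le_it le_jt; exact: Delta_ofE.
Qed.

End Coefficients.

Theorem proposition4 (R : realType) (k : nat)
  (mu : probability (measurableTypeR R) R) (hmu : compactly_supported mu)
  (dA : measure_display) (TA : measurableType dA) (PA : probability TA R)
  (A : 'I_k -> {RV PA >-> R})
  (hA : forall j, (A j : TA -> R) \in Lfun PA 2%:E)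
  (phi psi : forall t, nonlin R k t)
  (hphi : forall t, smooth_nonlin (phi t))
  (hpsi : forall t, smooth_nonlin (psi t)) :
  exists (eta : forall t, nonlin R k t) (c d : nat -> nat -> R)
    (post : forall t, nonlin R k t.+1),
  [/\ forall t, smooth_nonlin (eta t),
      limiting_coefficients A mu eta c d
    & forall (N : nat) (W : 'M[R]_N) (a : 'M[R]_(N, k)) (x : nat -> 'cV[R]_N),
        W^T = W -> GFOM phi psi W a x ->
        exists u ubar r : nat -> 'cV[R]_N,
          RI_AMP_DF eta c d W a u ubar r /\
          forall t, x t = rowwise (post t) r a].
Proof.
(* The coefficients are fixed first, from [mu], [A], [phi] and [psi]; the change of iterates is then
   an algebraic identity in every dimension [N]. *)
have [d dP] := limiting_coefficients_exist hmu hA hphi hpsi.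
exists (eta_of mu phi psi d), (c_coef mu d), d, (post_of mu phi psi d).
split=> // [t|N W a x _ xE]; first exact: smooth_eta_of.
exact: RI_AMP_DF_of_GFOM.
Qed.
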